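(* Fix a step $k$ and data $y_k$. In each of the following nine cases, for every $\mu$ in the indicated domain $\mathcal{D}_k$ and every $\mu' \in \mathcal{D}_k$, $$d(F_k\mu, F_k\mu') \le K(\mu;y_k)\, d(\mu,\mu'),$$ i.e. the prior-to-posterior map $F_k:(\mathcal{D}_k,d)\to(\mathcal{P}(\bar{\mathcal{X}}),d)$ is pointwise globally Lipschitz continuous, with the constant $K(\mu;y_k)$ given below. Inverse problems: (a) $d=d_{TV}$, $\mathcal{D}_k=\bar{\mathcal{P}}_k(\mathcal{X})$, under (IP.1): $K=\frac{C_h(y_k)}{Z_k(\mu)}$. (b) $d=d_H$, $\mathcal{D}_k=\bar{\mathcal{P}}_k(\mathcal{X})$, under (IP.1): $K=2\sqrt{\frac{C_h(y_k)}{Z_k(\mu)}}$. (c) $d=W_1$, $\mathcal{D}_k=\bar{\mathcal{P}}_k(\mathcal{X})\cap\mathcal{P}_1(\mathcal{X})$, under (IP.1), (IP.2), (B): $K=\frac{2D\|h\|_{\mathrm{Lip}}(y_k)+C_h(y_k)}{Z_k(\mu)}$. State estimation: (d) $d=d_{TV}$, $\mathcal{D}_k=\bar{\mathcal{P}}_k(\mathcal{X})$, under (SE.1): $K=\frac{C_{Th}(y_k;k)}{Z_k(\mu)}$. (e) $d=d_H$, $\mathcal{D}_k=\bar{\mathcal{P}}_k(\mathcal{X})$, under (SE.1): $K=2\sqrt{\frac{C_{Th}(y_k;k)}{Z_k(\mu)}}$. (f) $d=W_1$, $\mathcal{D}_k=\bar{\mathcal{P}}_k(\mathcal{X})\cap\mathcal{P}_1(\mathcal{X})$,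 under (SE.2), (B): $K=\frac{2DC^*_{Th}(y_k;k)}{Z_k(\mu)}$. Parameter-state estimation: (g) $d=d_{TV}$, $\mathcal{D}_k=\bar{\mathcal{P}}_k(\mathcal{X}\times\mathcal{W})$, under (PS.1): $K=\frac{\tilde C_{Th}(y_k;k)}{Z_k(\mu)}$. (h) $d=d_H$, $\mathcal{D}_k=\bar{\mathcal{P}}_k(\mathcal{X}\times\mathcal{W})$, under (PS.1): $K=2\sqrt{\frac{\tilde C_{Th}(y_k;k)}{Z_k(\mu)}}$. (i) $d=W_1$, $\mathcal{D}_k=\bar{\mathcal{P}}_k(\mathcal{X}\times\mathcal{W})\cap\mathcal{P}_1(\mathcal{X}\times\mathcal{W})$, under (PS.1), (PS.2), (PS.3), (B): $K=\frac{2D\tilde C^*_{Th}(y_k;k)+\tilde C_{Th}(y_k;k)}{Z_k(\mu)}$.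
   Context: Spaces: $(\mathcal{X},d_{\mathcal{X}})$ is a Polish metric space (state/unknown space) and, in parameter-state estimation, $(\mathcal{X}\times\mathcal{W},d_{\mathcal{X}\times\mathcal{W}})$ is a Polish metric space; $dx$, $dw$ denote Lebesgue (reference) measure and $\lambda$ is Lebesgue measure on $\mathcal{X}\times\mathcal{W}$. Write $\bar{\mathcal{X}}=\mathcal{X}$ in inverse problems and state estimation and $\bar{\mathcal{X}}=\mathcal{X}\times\mathcal{W}$ in parameter-state estimation; $\mathcal{P}(\bar{\mathcal{X}})$ is the set of Borel probability measures, and $\mathcal{P}_1(\bar{\mathcal{X}})$ those with finite first moment. Problems. Inverse problems (IP): a measurable likelihood $x\mapsto h(y_k,x)\ge0$; for a probability measure $\mu$ set $\tilde F_k\mu(dx)=h(y_k,x)\mu(dx)$. State estimation (SE): measurable transition density $T_k(x_k,x_{k-1})$ (a probability density in $x_k$ w.r.t. Lebesgue measure) and measurable observation density $h_k(y_k,x_k)$; set $\tilde F_k\mu(dx)=h_k(y_k,x)\big(\int_{\mathcal{X}}T_k(x,x_{k-1})\mu(dx_{k-1})\big)dx$. Parameter-state estimation (PS): measurable $T_k(x_k,x_{k-1},w)$ (density in $x_k$) and $h_k(y_k,x_k,w)$; for $\mu\ll\lambda$ with density $\pi$, set $\tilde F_k\mu(dx,dw)=h_k(y_k,x,w)\big(\int_{\mathcal{X}}T_k(x,x_{k-1},w)\pi(x_{k-1},w)dx_{k-1}\big)dx\,dw$. The evidence is $Z_k(\mu)=\tilde F_k\mu(\bar{\mathcal{X}})$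 and the posterior is $F_k\mu=\tilde F_k\mu/Z_k(\mu)$. Admissible priors $\bar{\mathcal{P}}_k(\bar{\mathcal{X}})$: in IP, $\{\mu\in\mathcal{P}(\mathcal{X}):0<\int h(y_k,x)\mu(dx)<\infty\}$; in SE, $\{\mu\in\mathcal{P}(\mathcal{X}):\int T_k(x_k,x_{k-1})\mu(dx_{k-1})<\infty\ \forall x_k,\ 0<Z_k(\mu)<\infty\}$; in PS, $\{\mu\in\mathcal{P}(\mathcal{X}\times\mathcal{W}):\mu\ll\lambda,\ \int T_k(x_k,x_{k-1},w)\frac{d\mu}{d\lambda}(x_{k-1},w)dx_{k-1}<\infty\ \forall x_k,w,\ 0<Z_k(\mu)<\infty\}$. Distances (with $\nu$ any $\sigma$-finite measure dominating $\mu,\mu'$): $d_{TV}(\mu,\mu')=\frac12\int|\frac{d\mu}{d\nu}-\frac{d\mu'}{d\nu}|d\nu$; $d_H(\mu,\mu')=\sqrt{\frac12\int(\sqrt{d\mu/d\nu}-\sqrt{d\mu'/d\nu})^2d\nu}$; $W_1(\mu,\mu')=\inf_{\gamma}\int d(z,z')\gamma(dz,dz')$ over couplings $\gamma$ of $\mu,\mu'$. Assumptions (for the given $y_k$): (IP.1) $C_h(y_k):=\sup_x h(y_k,x)<\infty$. (IP.2) $x\mapsto h(y_k,x)$ is globally Lipschitz with best constant $\|h\|_{\mathrm{Lip}}(y_k)$. (SE.1) $C_{Th}(y_k;k):=\sup_{x_{k-1}}\int_{\mathcal{X}}h_k(y_k,x)T_k(x,x_{k-1})dx<\infty$. (SE.2)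 $T_{\mathrm{Lip}}(x_k;k):=\sup_{x\ne x'}\frac{|T_k(x_k,x)-T_k(x_k,x')|}{d_{\mathcal{X}}(x,x')}<\infty$ for all $x_k$, and $C^*_{Th}(y_k;k):=\int_{\mathcal{X}}h_k(y_k,x_k)T_{\mathrm{Lip}}(x_k;k)dx_k<\infty$. (PS.1) $\tilde C_{Th}(y_k;k):=\sup_{x_{k-1},w}\int_{\mathcal{X}}h_k(y_k,x,w)T_k(x,x_{k-1},w)dx<\infty$. (PS.2) with $\tilde f_k(y_k,x_k,x,w):=h_k(y_k,x_k,w)T_k(x_k,x,w)$, $\tilde f_{\mathrm{Lip}}(x_k;k):=\sup_{(x,w)\ne(x',w')}\frac{|\tilde f_k(y_k,x_k,x,w)-\tilde f_k(y_k,x_k,x',w')|}{d_{\mathcal{X}\times\mathcal{W}}((x,w),(x',w'))}<\infty$ for all $x_k$, and $\tilde C^*_{Th}(y_k;k):=\int_{\mathcal{X}}\tilde f_{\mathrm{Lip}}(x_k;k)dx_k<\infty$. (PS.3) $d_{\mathcal{X}\times\mathcal{W}}((x,w),(x,w'))\le d_{\mathcal{X}\times\mathcal{W}}((\tilde x,w),(x',w'))$ for all $x,\tilde x,x'\in\mathcal{X}$, $w,w'\in\mathcal{W}$. (B) $D:=\sup_{\bar x,\bar x'\in\bar{\mathcal{X}}}d_{\bar{\mathcal{X}}}(\bar x,\bar x')<\infty$. *)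

(* Defs.v *)
From HB Require Import structures.
From mathcomp Require Import all_boot all_order all_algebra.
From mathcomp Require Import all_classical all_reals all_analysis.
Set Implicit Arguments. Unset Strict Implicit. Unset Printing Implicit Defensive.
Import Order.TTheory GRing.Theory Num.Theory.
Local Open Scope classical_set_scope.
Local Open Scope ring_scope.

Section metric_defs.
Context {R : realType}.

Definition is_metric {T : Type} (dist : T -> T -> R) :=
  [/\ forall x y, 0 <= dist x y,
      forall x y, dist x y = 0 <-> x = y,
      forall x y, dist x y = dist y x &
      forall x y z, dist x z <= dist x y + dist y z].

Definition metric_open {T : Type} (dist : T -> T -> R) (U : set T) :=
  forall x, U x -> exists2 e, 0 < e & forall z, dist x z < e -> U z.

Definition metric_complete {T : Type} (dist : T -> T -> R) :=
  forall u : nat -> T,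
    (forall e, 0 < e -> exists N, forall m n, (N <= m)%N -> (N <= n)%N ->
        dist (u m) (u n) < e) ->
    exists l, forall e, 0 < e -> exists N, forall n, (N <= n)%N -> dist (u n) l < e.

Definition metric_separable {T : Type} (dist : T -> T -> R) :=
  exists2 S : set T, countable S &
    forall x e, 0 < e -> exists2 z, S z & dist x z < e.

Definition polish_borel d (T : measurableType d) (dist : T -> T -> R) :=
  [/\ is_metric dist, metric_complete dist, metric_separable dist &
      forall A : set T, measurable A <-> <<s metric_open dist >> A].

Definition esup_fun {T : Type} (f : T -> R) : \bar R :=
  ereal_sup [set (f x)%:E | x in [set: T]].

Definition lip_const {T : Type} (dist : T -> T -> R) (f : T -> R) : \bar R :=
  ereal_sup [set (`|f z.1 - f z.2| / dist z.1 z.2)%:E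
             | z in [set z : T * T | z.1 <> z.2]].

Definition diam {T : Type} (dist : T -> T -> R) : \bar R :=
  ereal_sup [set (dist z.1 z.2)%:E | z in [set: T * T]].

End metric_defs.

Section distances.
Context {R : realType} (d : measure_display) (T : measurableType d).
Local Open Scope ereal_scope.

Definition dens_rep (nu : {measure set T -> \bar R}) (f : T -> R)
    (m : set T -> \bar R) :=
  [/\ sigma_finite setT nu, measurable_fun setT f, (forall x, (0 <= f x)%R) &
      forall A, measurable A -> m A = \int[nu]_(x in A) (f x)%:E].

Definition is_dTV (m m' : set T -> \bar R) (r : R) :=
  exists (nu : {measure set T -> \bar R}) (f f' : T -> R),
    [/\ dens_rep nu f m, dens_rep nu f' m' &
        r%:E = 2^-1%:E * \int[nu]_x (`|f x - f' x|)%:E].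

Definition is_dH (m m' : set T -> \bar R) (r : R) :=
  exists (nu : {measure set T -> \bar R}) (f f' : T -> R),
    [/\ dens_rep nu f m, dens_rep nu f' m', (0 <= r)%R &
        (r ^+ 2)%:E =
          2^-1%:E * \int[nu]_x ((Num.sqrt (f x) - Num.sqrt (f' x)) ^+ 2)%:E].

Definition coupling (g : set (T * T) -> \bar R) (m m' : set T -> \bar R) :=
  forall A, measurable A -> g (A `*` setT) = m A /\ g (setT `*` A) = m' A.

Definition W1 (dist : T -> T -> R) (m m' : set T -> \bar R) : \bar R :=
  ereal_inf [set \int[g]_z (dist z.1 z.2)%:E
            | g in [set g : probability (T * T)%type R | coupling g m m']].

Definition first_moment_finite (dist : T -> T -> R) (mu : set T -> \bar R) :=
  exists x0 : T, \int[mu]_x (dist x0 x)%:E < +oo.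

End distances.

(** Inverse problems: h is the likelihood x |-> h(y_k, x). *)
Section IP.
Context {R : realType} (d : measure_display) (X : measurableType d).
Local Open Scope ereal_scope.

Definition evid_IP (mu : set X -> \bar R) (h : X -> R) : \bar R :=
  \int[mu]_x (h x)%:E.

Definition post_IP (mu : set X -> \bar R) (h : X -> R) : set X -> \bar R :=
  fun A => (\int[mu]_(x in A) (h x)%:E) * ((fine (evid_IP mu h))^-1)%:E.

Definition admissible_IP (mu : set X -> \bar R) (h : X -> R) :=
  0 < evid_IP mu h < +oo.

End IP.

(** State estimation: Tk x_k x_{k-1} = T_k(x_k, x_{k-1}), h x_k = h_k(y_k, x_k),
    leb = reference measure dx. *)
Section SE.
Context {R : realType} (d : measure_display) (X : measurableType d).
Local Open Scope ereal_scope.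

Definition pred_SE (mu : set X -> \bar R) (Tk : X -> X -> R) (x : X) : \bar R :=
  \int[mu]_x' (Tk x x')%:E.

Definition tpost_SE (leb : set X -> \bar R) (mu : set X -> \bar R)
    (h : X -> R) (Tk : X -> X -> R) : set X -> \bar R :=
  fun A => \int[leb]_(x in A) ((h x)%:E * pred_SE mu Tk x).

Definition evid_SE leb mu h Tk : \bar R := @tpost_SE leb mu h Tk setT.

Definition post_SE leb mu h Tk : set X -> \bar R :=
  fun A => tpost_SE leb mu h Tk A * ((fine (evid_SE leb mu h Tk))^-1)%:E.

Definition admissible_SE leb (mu : set X -> \bar R) h Tk :=
  (forall x, pred_SE mu Tk x < +oo) /\ 0 < evid_SE leb mu h Tk < +oo.

Definition C_Th (leb : set X -> \bar R) (h : X -> R) (Tk : X -> X -> R) : \bar R :=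
  ereal_sup [set \int[leb]_x (h x * Tk x x')%:E | x' in [set: X]].

Definition T_lip (dist : X -> X -> R) (Tk : X -> X -> R) (xk : X) : \bar R :=
  lip_const dist (Tk xk).

Definition Cstar_Th (leb : set X -> \bar R) (dist : X -> X -> R)
    (h : X -> R) (Tk : X -> X -> R) : \bar R :=
  \int[leb]_xk ((h xk)%:E * T_lip dist Tk xk).

End SE.

(** Parameter-state estimation: Tk x_k x_{k-1} w, h x_k w = h_k(y_k, x_k, w),
    lebX = dx, lam = lambda = dx (x) dw, pi = d mu / d lambda. *)
Section PS.
Context {R : realType} (dx dw : measure_display)
  (X : measurableType dx) (W : measurableType dw).
Local Open Scope ereal_scope.

Definition prior_density (lam : set (X * W) -> \bar R) (mu : set (X * W) -> \bar R)
    (pi : X * W -> R) :=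
  [/\ measurable_fun setT pi, (forall z, (0 <= pi z)%R) &
      forall A, measurable A -> mu A = \int[lam]_(z in A) (pi z)%:E].

Definition pred_PS (lebX : set X -> \bar R) (Tk : X -> X -> W -> R)
    (pi : X * W -> R) (x : X) (w : W) : \bar R :=
  \int[lebX]_x' (Tk x x' w * pi (x', w))%:E.

Definition tpost_PS (lebX : set X -> \bar R) (lam : set (X * W) -> \bar R)
    (h : X -> W -> R) (Tk : X -> X -> W -> R) (pi : X * W -> R)
    : set (X * W) -> \bar R :=
  fun A => \int[lam]_(z in A) ((h z.1 z.2)%:E * pred_PS lebX Tk pi z.1 z.2).

Definition evid_PS lebX lam h Tk pi : \bar R := @tpost_PS lebX lam h Tk pi setT.

Definition post_PS lebX lam h Tk pi : set (X * W) -> \bar R :=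
  fun A => tpost_PS lebX lam h Tk pi A * ((fine (evid_PS lebX lam h Tk pi))^-1)%:E.

Definition admissible_PS lebX lam (mu : set (X * W) -> \bar R) h Tk pi :=
  [/\ prior_density lam mu pi,
      (forall x w, pred_PS lebX Tk pi x w < +oo) &
      0 < evid_PS lebX lam h Tk pi < +oo].

Definition tC_Th (lebX : set X -> \bar R) (h : X -> W -> R)
    (Tk : X -> X -> W -> R) : \bar R :=
  ereal_sup [set \int[lebX]_x (h x z.2 * Tk x z.1 z.2)%:E
            | z in [set: X * W]].

Definition f_lip (dist : X * W -> X * W -> R) (h : X -> W -> R)
    (Tk : X -> X -> W -> R) (xk : X) : \bar R :=
  lip_const dist (fun z : X * W => (h xk z.2 * Tk xk z.1 z.2)%R).

Definition tCstar_Th (lebX : set X -> \bar R) (dist : X * W -> X * W -> R)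
    (h : X -> W -> R) (Tk : X -> X -> W -> R) : \bar R :=
  \int[lebX]_xk f_lip dist h Tk xk.

End PS.

(* Main.v *)
(** Each of the three updates has the form
      [F~ mu (A) = \int mu(dx) \int rho(de) q(e, x) 1_A (th(e, x))]
    for some sigma-finite [rho]: for inverse problems [rho] is a Dirac mass,
    [q = h(x)], [th = x]; for state estimation [rho = dx], [q = h(e) T(e, x)],
    [th = e]; for parameter-state estimation [q = h(e, w) T(e, x, w)] and
    [th = (e, w)].  With [C] bounding [\int q(e, x) rho(de)]:
    - total variation: [Z (F mu - F mu')(A)] is the integral against [mu - mu']
      of [x |-> \int q (1_A(th) - F mu'(A)) de], whose oscillation is at most [C];
    - Hellinger: the pointwise variational formula
      [(sqrt a - sqrt b)^2 = sup_(t > 0) a (1 - t) + b (1 - t^-1)] passes through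
      the kernel and gives the unnormalized bound; normalization then only
      requires an inequality between real numbers;
    - Wasserstein: a coupling [g] of [mu], [mu'] is pushed by
      [(th(e, x), th(e, x'))] with density [min(q(e, x), q(e, x')) / max(Z, Z')],
      and the two residuals, whose mass is at most the integral of
      [|q(e, x) - q(e, x')| / max(Z, Z')], are coupled independently. *)
Require Import Defs.
From HB Require Import structures.
From mathcomp Require Import all_boot all_order all_algebra.
From mathcomp Require Import all_classical all_reals all_analysis.
From mathcomp Require Import ring lra measurable_realfun.
Set Implicit Arguments. Unset Strict Implicit. Unset Printing Implicit Defensive.
Import Order.TTheory GRing.Theory Num.Theory.
Import numFieldNormedType.Exports.
Local Open Scope classical_set_scope.
Local Open Scope ring_scope.

(** * Densities and push-forwards *)

Section pushforward_density.
Context {R : realType} {d d' : measure_display} {O : measurableType d}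
  {T : measurableType d'}.
Local Open Scope ereal_scope.
Implicit Types (P : {measure set O -> \bar R}) (b : O -> R) (th : O -> T).

(** The integral of a nonnegative function is a supremum over the simple functions below it, and
    this family grows with the function, so measurability does not enter. It serves for the
    pointwise Lipschitz constants, which are suprema over possibly uncountable families. *)
Lemma ge0_le_integral_nonmeasurable P (f g : O -> \bar R) :
  (forall x, 0 <= f x) -> (forall x, f x <= g x) ->
  \int[P]_x f x <= \int[P]_x g x.
Proof.
move=> f0 fg; rewrite !ge0_integralTE//; last by move=> x; exact: le_trans (fg x).
apply: ge_ereal_sup => _ [h hf <-]; apply: ereal_sup_ubound; exists h => // x.
exact: le_trans (hf x) (fg x).
Qed.

(** This is the image under [th] of the measure with density [b]. Preimages of disjoint sets are
    disjoint, so sigma-additivity is inherited from the integral. The coupling in [W1_le_overlap] is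
    assembled from such measures. *)
Lemma pushforward_density_exists P b th :
  measurable_fun setT b -> (forall w, (0 <= b w)%R) -> measurable_fun setT th ->
  exists m : {measure set T -> \bar R}, forall A,
    m A = \int[P]_(w in th @^-1` A) (b w)%:E.
Proof.
move=> mb b0 mth; pose m A := \int[P]_(w in th @^-1` A) (b w)%:E.
have m0 : m set0 = 0 by rewrite /m preimage_set0 integral_set0.
have mge0 A : 0 <= m A by apply: integral_ge0 => w _; rewrite lee_fin.
have madd : semi_sigma_additive m.
  move=> F mF tF mUF; rewrite /m preimage_bigcup ge0_integral_bigcup//.
  - by apply: is_cvg_ereal_nneg_natsum => n _; exact: mge0.
  - by move=> k; rewrite -[X in measurable X]setTI; exact: mth.
  - exact/measurable_EFinP/measurable_funTS.
  - by move=> w _; rewrite lee_fin.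
  - apply/trivIsetP => i j _ _ ij; rewrite -preimage_setI.
    by move/trivIsetP : tF => ->//; rewrite preimage_set0.
pose M := isMeasure.Build _ _ _ m m0 mge0 madd.
pose mm : {measure set T -> \bar R} := HB.pack m M.
by exists mm.
Qed.

Import HBNNSimple.

(** Change of variables: linearity extends the hypothesis from indicators to simple functions, and
    monotone convergence extends it to [t]. Taking [th := id] gives integration against a density,
    and [b := cst 1] integration against an image measure. *)
Lemma ge0_integral_pushforward_density P (m : {measure set T -> \bar R}) b th
    (t : T -> \bar R) :
  measurable_fun setT b -> (forall w, (0 <= b w)%R) -> measurable_fun setT th ->
  (forall A, measurable A -> m A = \int[P]_w (b w * \1_A (th w))%:E) ->
  measurable_fun setT t -> (forall x, 0 <= t x) ->
  \int[m]_x t x = \int[P]_w ((b w)%:E * t (th w)).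
Proof.
move=> mb b0 mth mE mt t0.
pose f_ := nnsfun_approx measurableT mt.
have cf x : (f_ n x)%:E @[n --> \oo] --> t x by exact: cvg_nnsfun_approx.
have mf n : measurable_fun setT (fun w => f_ n (th w)).
  exact: measurableT_comp.
have ndf x k n : (k <= n)%N -> (f_ k x <= f_ n x)%R.
  by move=> kn; exact/lefP/nd_nnsfun_approx.
transitivity (limn (fun n => \int[m]_x (f_ n x)%:E)).
  rewrite -monotone_convergence//.
  - by apply: eq_integral => x _; apply/esym/cvg_lim => //; exact: cf.
  - by move=> n; exact/measurable_EFinP.
  - by move=> n x _; rewrite lee_fin.
  - by move=> x _ k n kn; rewrite lee_fin ndf.
rewrite [X in limn X](_ : _ = (fun n => \int[P]_w (b w * f_ n (th w))%:E)); last first.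
  apply/funext => n.
  under eq_integral do rewrite fimfunE -fsumEFin//.
  rewrite ge0_integral_fsum//; last 2 first.
  - by move=> r; apply/measurable_EFinP/measurable_funM.
  - by move=> r x _; rewrite nnfun_muleindic_ge0.
  under [in RHS]eq_integral => w _.
    rewrite fimfunE mulr_fsumr -fsumEFin//.
    over.
  rewrite /= ge0_integral_fsum//; last 2 first.
  - move=> r; apply/measurable_EFinP/measurable_funM => //.
    apply/measurable_funM => //.
    by apply: measurableT_comp mth; exact: measurable_indic.
  - by move=> r w _; rewrite EFinM mule_ge0 ?lee_fin// -lee_fin nnfun_muleindic_ge0.
  apply: eq_fsbigr => r _.
  have mA : measurable (f_ n @^-1` [set r]) by [].
  (* Pulling [r] out of the integral uses [0 <= r]. A negative [r] is not a value of [f_ n], so its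
     level set is empty and both sides vanish. *)
  have [r0|r0] := ltP r 0%R.
    rewrite !integral0_eq// => x _; rewrite preimage_nnfun0// indic0 !mulr0//.
  rewrite integralZl_indic_nnsfun// integral_indic// setIT mE//.
  rewrite -ge0_integralZl//; last 2 first.
  - apply/measurable_EFinP/measurable_funM => //.
    by apply: measurableT_comp mth; exact: measurable_indic.
  - by move=> w _; rewrite lee_fin mulr_ge0.
  by apply: eq_integral => w _; rewrite -EFinM mulrCA.
rewrite -monotone_convergence//.
- apply: eq_integral => w _; under [X in limn X]eq_fun do rewrite EFinM.
  by apply/cvg_lim => //; apply: cvgeZl => //; exact: cf.
- by move=> n; apply/measurable_EFinP/measurable_funM.
- by move=> n w _; rewrite lee_fin mulr_ge0.
- by move=> w _ k n kn; rewrite lee_fin ler_wpM2l// ndf.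
Qed.

End pushforward_density.

(** * Integration against densities and a set attaining the total variation distance *)

Section density.
Context {R : realType} {d : measure_display} {T : measurableType d}.
Local Open Scope ereal_scope.

Lemma ge0_integralD_EFin (m : {measure set T -> \bar R}) (f g : T -> R) :
  measurable_fun setT f -> measurable_fun setT g ->
  (forall x, (0 <= f x)%R) -> (forall x, (0 <= g x)%R) ->
  \int[m]_x (f x + g x)%:E = \int[m]_x (f x)%:E + \int[m]_x (g x)%:E.
Proof.
move=> mf mg f0 g0; under eq_integral do rewrite EFinD.
by rewrite ge0_integralD//; try exact/measurable_EFinP; move=> x _; rewrite lee_fin.
Qed.

Lemma ge0_integralM_EFin (m : {measure set T -> \bar R}) (k : R) (f : T -> R) :
  measurable_fun setT f -> (0 <= k)%R -> (forall x, (0 <= f x)%R) ->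
  \int[m]_x (k * f x)%:E = k%:E * \int[m]_x (f x)%:E.
Proof.
move=> mf k0 f0; under eq_integral do rewrite EFinM.
by rewrite ge0_integralZl_EFin//; try exact/measurable_EFinP; move=> x _; rewrite lee_fin.
Qed.

Lemma integral_indicr (m : {measure set T -> \bar R}) (f : T -> R) (A : set T) :
  \int[m]_(x in A) (f x)%:E = \int[m]_x (f x * \1_A x)%:E.
Proof.
rewrite integral_mkcond; apply: eq_integral => x _.
by rewrite patchE indicE; case: ifPn => _; rewrite ?mulr1 ?mulr0.
Qed.

Lemma ge0_integral_density (nu m : {measure set T -> \bar R}) (f : T -> R)
    (t : T -> \bar R) :
  dens_rep nu f m -> measurable_fun setT t -> (forall x, 0 <= t x) ->
  \int[m]_x t x = \int[nu]_x ((f x)%:E * t x).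
Proof.
move=> [_ mf f0 mE] mt t0.
rewrite (ge0_integral_pushforward_density (P := nu) (b := f) (th := id))//.
by move=> A mA; rewrite mE// integral_indicr.
Qed.

Lemma dens_rep_indic (nu : {measure set T -> \bar R}) f (m : set T -> \bar R) A :
  dens_rep nu f m -> measurable A -> m A = \int[nu]_x (f x * \1_A x)%:E.
Proof. by move=> [_ _ _ mE] mA; rewrite mE// integral_indicr. Qed.

Lemma dens_rep_setT (nu : {measure set T -> \bar R}) f (m : set T -> \bar R) :
  dens_rep nu f m -> m setT = \int[nu]_x (f x)%:E.
Proof. by move=> [_ _ _ mE]; rewrite mE. Qed.

Lemma dens_rep_fin_num (nu : {measure set T -> \bar R}) f (m : set T -> \bar R) A :
  dens_rep nu f m -> m setT = 1 -> measurable A -> m A \is a fin_num.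
Proof.
move=> [_ mf f0 mE] m1 mA; rewrite ge0_fin_numE; last first.
  by rewrite mE// integral_ge0// => x _; rewrite lee_fin.
apply: (@le_lt_trans _ _ (m setT)); last by rewrite m1 ltry.
rewrite !mE//; apply: ge0_subset_integral => //; first exact/measurable_EFinP.
by move=> x _; rewrite lee_fin.
Qed.

(** The Hahn set [f' < f] attains the distance: both masses are 1, so the positive and negative
    parts of [f - f'] have the same integral, namely [r]. *)
Lemma is_dTV_witness (m m' : set T -> \bar R) (r : R) :
  m setT = 1 -> m' setT = 1 -> is_dTV m m' r ->
  exists2 A, measurable A & r%:E + m' A = m A.
Proof.
move=> m1 m'1 [nu [f [f' [dm dm' rE]]]].
have [[_ mf f0 mE] [_ mf' f'0 m'E]] := (dm, dm').
pose A := [set x | (f' x < f x)%R].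
have mA : measurable A.
  by rewrite -[A]setTI; apply: measurable_fun_ltr.
exists A => //.
have mIA : measurable_fun setT (\1_A : T -> R) by exact: measurable_indic.
(* Integrated form of [|f - f'| + f + 2 f' 1_A = 2 f 1_A + f'], arranged so that only nonnegative
   terms are added. *)
have key : 2%:E * r%:E + m setT + 2%:E * m' A = 2%:E * m A + m' setT.
  have -> : 2%:E * r%:E = \int[nu]_x (`|f x - f' x|)%:E.
    by rewrite rE muleA -EFinM divff// mul1e.
  rewrite (dens_rep_setT dm) (dens_rep_setT dm').
  rewrite (dens_rep_indic dm mA) (dens_rep_indic dm' mA).
  have mff : measurable_fun setT (fun x => `|f x - f' x|)%R.
    by apply: measurableT_comp => //; exact: measurable_funB.
  rewrite -!ge0_integralM_EFin//; try by [move=> x; exact: mulr_ge0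
    | exact: measurable_funM].
  rewrite -!ge0_integralD_EFin//;
    try by [move=> x; rewrite ?addr_ge0 ?mulr_ge0
    |repeat (apply: measurable_funD || apply: measurable_funM)].
  apply: eq_integral => x _; congr EFin; rewrite indicE.
  have [/set_mem /= xA|] := boolP (x \in A).
    by rewrite gtr0_norm ?subr_gt0//=; ring.
  move=> /negP xA; have : ~ A x by move=> /mem_set.
  by rewrite /A/= => /negP; rewrite -leNgt => xx; rewrite ler0_norm ?subr_le0//; ring.
have mAf : m A \is a fin_num by exact: (dens_rep_fin_num dm).
have m'Af : m' A \is a fin_num by exact: (dens_rep_fin_num dm').
move: key; rewrite m1 m'1 -(fineK mAf) -(fineK m'Af) -!EFinM -!EFinD => -[key].
by congr EFin; lra.
Qed.

End density.

(** * Test functions for the total variation and Hellinger distances *)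

Section hellinger_algebra.
Context {R : realType}.

(* AM-GM: [(a - b)^2] is the supremum over [t > 0] of [(1 - t) a^2 + (1 - t^-1) b^2];
   the optimal [t = b / a] is perturbed so that it stays positive *)
Lemma hellinger_perturbed (a b e : R) : 0 <= a -> 0 <= b -> 0 < e ->
  0 < b + e * a -> 0 < a + e * b ->
  (a - b) ^+ 2 + (b + e * a) / (a + e * b) * a ^+ 2 +
    (a + e * b) / (b + e * a) * b ^+ 2 <= (1 + e) * (a ^+ 2 + b ^+ 2).
Proof.
move=> a0 b0 e0 n0 d0; rewrite -subr_ge0.
set n := b + e * a in n0 *; set d := a + e * b in d0 *.
have -> : (1 + e) * (a ^+ 2 + b ^+ 2) -
    ((a - b) ^+ 2 + n / d * a ^+ 2 + d / n * b ^+ 2) =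
    (e * (a ^+ 2 + b ^+ 2) * (n * d) - (a * n - b * d) ^+ 2) / (n * d).
  by field; rewrite !gt_eqF.
apply: divr_ge0; last by rewrite mulr_ge0 ?ltW.
rewrite subr_ge0.
(* The products [a b] cancel in [a n - b d], so the square is of order [e ^+ 2]. It is dominated
   because [n d = e (a^2 + b^2) + (1 + e^2) a b]. *)
have -> : (a * n - b * d) ^+ 2 = e ^+ 2 * (a ^+ 2 - b ^+ 2) ^+ 2.
  by rewrite /n /d; ring.
apply: (@le_trans _ _ (e ^+ 2 * (a ^+ 2 + b ^+ 2) ^+ 2)).
  apply: ler_wpM2l; first exact: sqr_ge0.
  by have := sqr_ge0 (a * b); nra.
rewrite [leRHS](_ : _ = e ^+ 2 * (a ^+ 2 + b ^+ 2) ^+ 2 +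
  e * (a ^+ 2 + b ^+ 2) * (1 + e ^+ 2) * (a * b)); last by rewrite /n /d; ring.
by rewrite lerDl !mulr_ge0 ?addr_ge0 ?sqr_ge0// ltW.
Qed.

(** The easy half of the variational formula, valid for every [t]: the gap is the perfect square
    [(t a - b)^2 / t]. *)
Lemma hellinger_le_test (f g t : R) : 0 <= f -> 0 <= g -> 0 < t ->
  f + g <= (Num.sqrt f - Num.sqrt g) ^+ 2 + t * f + t^-1 * g.
Proof.
move=> f0 g0 t0; set a := Num.sqrt f; set b := Num.sqrt g.
have <- : a ^+ 2 = f by exact: sqr_sqrtr.
have <- : b ^+ 2 = g by exact: sqr_sqrtr.
rewrite -subr_ge0.
rewrite [leRHS](_ : _ = (t * a - b) ^+ 2 / t); last by field; rewrite gt_eqF.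
by rewrite divr_ge0 ?sqr_ge0// ltW.
Qed.

(* [x, y] are the square roots of the evidences, [s] the squared [L^2] distance
   of the square roots of the normalized densities *)
Lemma hellinger_normalization (x y s : R) : 0 < x -> 0 < y -> 0 <= s <= 2 ->
  x ^+ 2 * s <= 4 * ((x - y) ^+ 2 + x * y * s).
Proof.
(* If [x <= 4 y], the term [4 x y s] suffices. Otherwise [x - y > 3 x / 4], and
   [4 (x - y)^2 >= 9/4 x^2] exceeds [2 x^2 >= x^2 s]. *)
move=> x0 y0 /andP[s0 s2]; have [xy|xy] := leP x (4 * y).
  have : 0 <= x * s * (4 * y - x) by rewrite !mulr_ge0 ?subr_ge0// ltW.
  by have := sqr_ge0 (x - y); nra.
have h1 : x ^+ 2 * s <= x ^+ 2 * 2 by rewrite ler_wpM2l// sqr_ge0.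
have h2 : 0 <= x * y * s by rewrite !mulr_ge0// ltW.
have h3 : (3 * x) ^+ 2 <= (4 * (x - y)) ^+ 2 by rewrite ler_sqr ?nnegrE; lra.
by nra.
Qed.

End hellinger_algebra.

Section test_functions.
Context {R : realType} {d : measure_display} {T : measurableType d}.
Local Open Scope ereal_scope.

Lemma measurable_fun_inv_gt0 (f : T -> R) : measurable_fun setT f ->
  (forall x, (0 < f x)%R) -> measurable_fun setT (fun x => (f x)^-1%R).
Proof.
move=> mf f0; rewrite [X in measurable_fun _ X](_ : _ = GRing.inv \o f)//.
apply: (@measurable_comp _ _ _ _ _ _ [set r : R | r != 0%R]) => //.
- exact: open_measurable.
- by move=> _ [x _ <-] /=; rewrite gt_eqF.
- apply: open_continuous_measurable_fun => //; apply/in_setP => x /= x0.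
  exact: inv_continuous.
Qed.

Lemma measurable_fun_sqrt (f : T -> R) : measurable_fun setT f ->
  measurable_fun setT (fun x => Num.sqrt (f x)).
Proof.
move=> mf; apply: measurableT_comp mf.
by apply: continuous_measurable_fun; exact: sqrt_continuous.
Qed.

Lemma measurable_sqrt_diff (f g : T -> R) :
  measurable_fun setT f -> measurable_fun setT g ->
  measurable_fun setT (fun x => (Num.sqrt (f x) - Num.sqrt (g x)) ^+ 2)%R.
Proof.
move=> mf mg; apply: measurable_funX.
by apply: measurable_funB; exact: measurable_fun_sqrt.
Qed.

(** The function [u - c v] takes values in [[- c C, (1 - c) C]], an interval of length [C], so its
    integrals against [mu] and [mu'] differ by at most [C r]. Terms are moved across the inequality
    to avoid subtraction in the extended reals. *)
Lemma is_dTV_test (mu mu' : probability T R) (r C c : R) (u v : T -> R) :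
  is_dTV mu mu' r -> measurable_fun setT u -> measurable_fun setT v ->
  (forall x, 0 <= u x <= v x)%R -> (forall x, v x <= C)%R -> (0 <= c <= 1)%R ->
  \int[mu]_x (u x)%:E + c%:E * \int[mu']_x (v x)%:E <=
  \int[mu']_x (u x)%:E + c%:E * \int[mu]_x (v x)%:E + (C * r)%:E.
Proof.
move=> [nu [f [f' [dm dm' rE]]]] mu_ mv uv vC /andP[c0 c1].
have [[_ mf f0 mE] [_ mf' f'0 m'E]] := (dm, dm').
have u0 x : (0 <= u x)%R by have /andP[] := uv x.
have v0 x : (0 <= v x)%R by have /andP[? ?] := uv x; exact: le_trans (u0 x) _.
have C0 : (0 <= C)%R by exact: le_trans (v0 point) (vC _).
have mue : measurable_fun setT (EFin \o u) by exact/measurable_EFinP.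
have mve : measurable_fun setT (EFin \o v) by exact/measurable_EFinP.
have ue x : 0 <= (u x)%:E by rewrite lee_fin.
have ve x : 0 <= (v x)%:E by rewrite lee_fin.
have f1 : \int[nu]_x (f x)%:E = 1 by rewrite -(dens_rep_setT dm) probability_setT.
have f'1 : \int[nu]_x (f' x)%:E = 1 by rewrite -(dens_rep_setT dm') probability_setT.
rewrite !(ge0_integral_density dm)// !(ge0_integral_density dm')//.
have -> : (C * r)%:E = (C / 2)%:E * \int[nu]_x (`|f x - f' x|)%:E.
  have -> : \int[nu]_x (`|f x - f' x|)%:E = (2 * r)%:E.
    by rewrite EFinM rE muleA -EFinM divff// mul1e.
  by rewrite -EFinM; congr EFin; field.
(* Centering: the midpoint [C / 2 - c C] of the range of [u - c v] integrates to 0 against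
   [mu - mu']. Writing the added constant with [f] and [f'] interchanged on the two sides subtracts
   it, after which the inequality holds pointwise. *)
rewrite -(@leeD2rE _ (C / 2 + c * C)%:E)//.
have CcE : (C / 2 + c * C)%:E =
    (C / 2)%:E * \int[nu]_x (f' x)%:E + (c * C)%:E * \int[nu]_x (f x)%:E.
  by rewrite f1 f'1 !mule1 -EFinD.
have CcE' : (C / 2 + c * C)%:E =
    (C / 2)%:E * \int[nu]_x (f x)%:E + (c * C)%:E * \int[nu]_x (f' x)%:E.
  by rewrite f1 f'1 !mule1 -EFinD.
rewrite {1}CcE CcE'.
under [X in X + _ + _ <= _]eq_integral do rewrite -EFinM.
under [X in _ + _ * X + _ <= _]eq_integral do rewrite -EFinM.
under [X in _ <= X + _ + _ + _]eq_integral do rewrite -EFinM.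
under [X in _ <= _ + _ * X + _ + _]eq_integral do rewrite -EFinM.
have mff : measurable_fun setT (fun x => `|f x - f' x|)%R.
  by apply: measurableT_comp => //; exact: measurable_funB.
have C20 : (0 <= C / 2)%R by rewrite divr_ge0.
have cC0 : (0 <= c * C)%R by rewrite mulr_ge0.
rewrite -!ge0_integralM_EFin//; try by [move=> x; exact: mulr_ge0
  | exact: measurable_funM].
rewrite -!ge0_integralD_EFin//;
  try by [move=> x; rewrite ?addr_ge0 ?mulr_ge0
  |repeat (apply: measurable_funD || apply: measurable_funM)].
apply: ge0_le_integral => //;
  try by [move=> x _; rewrite lee_fin ?addr_ge0 ?mulr_ge0
  |apply/measurable_EFinP; repeat (apply: measurable_funD || apply: measurable_funM)].
move=> x _; rewrite lee_fin.
have /andP[a1 a2] := uv x.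
have [ff|ff] := leP (f' x) (f x).
  rewrite ger0_norm ?subr_ge0//.
  have : (0 <= (f x - f' x) * (C - v x))%R by rewrite mulr_ge0 ?subr_ge0.
  have : (0 <= (f x - f' x) * (v x - u x))%R by rewrite mulr_ge0 ?subr_ge0.
  have : (0 <= (f x - f' x) * ((1 - c) * (C - v x)))%R by rewrite !mulr_ge0 ?subr_ge0.
  nra.
rewrite ltr0_norm ?subr_lt0//.
have : (0 <= (f' x - f x) * (c * (C - v x)))%R.
  by rewrite !mulr_ge0 ?subr_ge0// ltW.
have : (0 <= (f' x - f x) * u x)%R by rewrite mulr_ge0 ?subr_ge0// ltW.
nra.
Qed.

(** The converse half of the variational formula: a single measurable [t], close to the optimal
    [sqrt (g' / g)], loses only a relative error [e] at every point. *)
Lemma hellinger_witness (g g' : T -> R) (e : R) :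
  measurable_fun setT g -> measurable_fun setT g' ->
  (forall x, (0 <= g x)%R) -> (forall x, (0 <= g' x)%R) -> (0 < e)%R ->
  exists t : T -> R, [/\ measurable_fun setT t, forall x, (0 < t x)%R &
    forall x, ((Num.sqrt (g x) - Num.sqrt (g' x)) ^+ 2 + t x * g x + (t x)^-1 * g' x
      <= (1 + e) * (g x + g' x))%R].
Proof.
move=> mg mg' g0 g'0 e0.
pose a x := Num.sqrt (g x); pose b x := Num.sqrt (g' x).
have ma : measurable_fun setT a by exact: measurable_fun_sqrt.
have mb : measurable_fun setT b by exact: measurable_fun_sqrt.
have a0 x : (0 <= a x)%R by exact: sqrtr_ge0.
have b0 x : (0 <= b x)%R by exact: sqrtr_ge0.
have aE x : g x = (a x ^+ 2)%R by rewrite sqr_sqrtr.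
have bE x : g' x = (b x ^+ 2)%R by rewrite sqr_sqrtr.
(* the indicator makes t = 1 where g = g' = 0 *)
pose Z : set T := [set x | (a x + b x <= 0)%R].
have mZ : measurable Z.
  rewrite -[Z]setTI; apply: measurable_fun_ler => //; exact: measurable_funD.
have mi : measurable_fun setT (\1_Z : T -> R) by exact: measurable_indic.
pose num x := (b x + e * a x + \1_Z x)%R.
pose den x := (a x + e * b x + \1_Z x)%R.
have Zx x : x \in Z -> a x = 0%R /\ b x = 0%R.
  by move=> /set_mem; rewrite /Z/= => ab; have := a0 x; have := b0 x; split; lra.
have pos x : (0 < num x)%R /\ (0 < den x)%R.
  rewrite /num /den indicE; case: (boolP (x \in Z)) => [/Zx[-> ->]|xZ] /=.
    by split; rewrite mulr0 !add0r.
  have ab : (0 < a x + b x)%R.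
    by rewrite ltNge; apply: contra xZ => abx; apply/mem_set.
  rewrite !addr0; have := a0 x; have := b0 x => b0x a0x.
  by split; have := mulr_ge0 (ltW e0) b0x; have := mulr_ge0 (ltW e0) a0x; nra.
have [mn md] : measurable_fun setT num /\ measurable_fun setT den.
  by split; repeat (apply: measurable_funD || apply: measurable_funM).
exists (fun x => num x / den x)%R; split.
- apply: measurable_funM => //; apply: measurable_fun_inv_gt0 => // x.
  by have [] := pos x.
- by move=> x; have [? ?] := pos x; rewrite divr_gt0.
- move=> x; rewrite invf_div; suff : ((a x - b x) ^+ 2 + num x / den x * a x ^+ 2 +
      den x / num x * b x ^+ 2 <= (1 + e) * (a x ^+ 2 + b x ^+ 2))%R by rewrite -aE -bE.
  have [] := pos x; rewrite /num /den indicE.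
  case: (boolP (x \in Z)) => [/Zx[-> ->] _ _|_] /=.
    by rewrite subr0 expr0n/= !(mulr0, addr0).
  by rewrite !addr0; exact: hellinger_perturbed.
Qed.

End test_functions.

(** * Updates by a kernel *)

Lemma evidence_gt0 {R : realType} (z : \bar R) :
  (0 < z < +oo)%E -> exists2 z', 0 < z' & z = z'%:E.
Proof.
move=> /andP[a b]; exists (fine z); first by rewrite fine_gt0 ?a.
by rewrite fineK// ge0_fin_numE// ltW.
Qed.

(** * Kernel updates and the total variation bound *)

Section kernel_update.
Context {R : realType} {dE dX : measure_display} {E : measurableType dE}
  {X : measurableType dX}.
Variables (rho : {sigma_finite_measure set E -> \bar R}) (q : E -> X -> R)
  (th : E -> X -> X).
Local Open Scope ereal_scope.

(** The unnormalized update of the Dirac mass at [x], tested against [t]. The update is linear in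
    the prior, so averaging this over [mu] gives the update of [mu]. *)
Definition kernel_int (t : X -> R) (x : X) : \bar R :=
  \int[rho]_e (q e x * t (th e x))%:E.

Definition kernel_update (mu : set X -> \bar R) (A : set X) : \bar R :=
  \int[mu]_x kernel_int \1_A x.

Definition kernel_posterior (mu : set X -> \bar R) (A : set X) : \bar R :=
  kernel_update mu A * ((fine (kernel_update mu setT))^-1)%:E.

Hypothesis mq : measurable_fun setT (fun z : E * X => q z.1 z.2).
Hypothesis q0 : forall e x, (0 <= q e x)%R.
Hypothesis mth : measurable_fun setT (fun z : E * X => th z.1 z.2).

Lemma measurable_kernel_integrand (t : X -> R) : measurable_fun setT t ->
  measurable_fun setT (fun z : E * X => q z.1 z.2 * t (th z.1 z.2))%R.
Proof. by move=> mt; apply: measurable_funM => //; exact: measurableT_comp mt mth. Qed.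

Lemma measurable_kernel_section x : measurable_fun setT (q ^~ x).
Proof. exact: (measurableT_comp mq (pair2_measurable x)). Qed.

Lemma measurable_kernel_point x : measurable_fun setT (th ^~ x).
Proof. exact: (measurableT_comp mth (pair2_measurable x)). Qed.

Lemma kernel_int_ge0 (t : X -> R) x : (forall x, (0 <= t x)%R) -> 0 <= kernel_int t x.
Proof. by move=> t0; apply: integral_ge0 => e _; rewrite lee_fin mulr_ge0. Qed.

Lemma measurable_kernel_int (t : X -> R) : measurable_fun setT t ->
  (forall x, (0 <= t x)%R) -> measurable_fun setT (kernel_int t).
Proof.
move=> mt t0; apply: (measurable_fun_fubini_tonelli_G (m1 := rho)
    (fun z : E * X => (q z.1 z.2 * t (th z.1 z.2))%:E)).
  apply/measurable_EFinP. exact: measurable_kernel_integrand.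
by move=> z; rewrite lee_fin mulr_ge0.
Qed.

Lemma kernel_int_setT x : kernel_int \1_setT x = \int[rho]_e (q e x)%:E.
Proof. by apply: eq_integral => e _; rewrite indicT mulr1. Qed.

(** [M] agrees on measurable sets with the image under [th] of the measure with density [k q] with
    respect to [rho \x mu]; change of variables and Tonelli then apply. The posterior corresponds to
    [k = Z^-1]. *)
Lemma integral_kernel_update (M : {measure set X -> \bar R}) (mu : probability X R)
    (k : R) (t : X -> R) : (0 <= k)%R ->
  (forall A, measurable A -> M A = k%:E * kernel_update mu A) ->
  measurable_fun setT t -> (forall x, (0 <= t x)%R) ->
  \int[M]_x (t x)%:E = k%:E * \int[mu]_x kernel_int t x.
Proof.
move=> k0 ME mt t0.
have fub (s : X -> R) : measurable_fun setT s -> (forall x, (0 <= s x)%R) ->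
    \int[rho \x mu]_z (k * q z.1 z.2 * s (th z.1 z.2))%:E =
    k%:E * \int[mu]_x kernel_int s x.
  move=> ms s0; have mqs := measurable_kernel_integrand ms.
  under eq_integral do rewrite -mulrA.
  rewrite ge0_integralM_EFin//; last by move=> z; rewrite mulr_ge0.
  rewrite (fubini_tonelli2 (fun z => (q z.1 z.2 * s (th z.1 z.2))%:E))//.
    exact/measurable_EFinP.
  by move=> z; rewrite lee_fin mulr_ge0.
rewrite (ge0_integral_pushforward_density (P := rho \x mu)
    (b := (fun z => k * q z.1 z.2)%R) (th := fun z => th z.1 z.2)) ?fub//.
- exact: measurable_funM.
- by move=> z; rewrite mulr_ge0.
- by move=> A mA; rewrite ME// fub.
- exact/measurable_EFinP.
Qed.

Variable C : R.
Hypothesis qC : forall x, \int[rho]_e (q e x)%:E <= C%:E.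

Lemma kernel_int_indic_fin A x : measurable A ->
  [/\ 0 <= kernel_int \1_A x, kernel_int \1_A x <= kernel_int \1_setT x,
      kernel_int \1_setT x <= C%:E & kernel_int \1_A x \is a fin_num].
Proof.
move=> mA; have h0 : 0 <= kernel_int \1_A x by exact: kernel_int_ge0.
have h1 : kernel_int \1_setT x <= C%:E by rewrite kernel_int_setT.
have h2 : kernel_int \1_A x <= kernel_int \1_setT x.
  apply: ge0_le_integral_nonmeasurable => e; rewrite lee_fin ?mulr_ge0//.
  by rewrite indicT ler_wpM2l// indicE; case: (_ \in _).
split=> //; rewrite ge0_fin_numE//.
exact: le_lt_trans h2 (le_lt_trans h1 (ltry _)).
Qed.

Theorem kernel_posterior_dTV (mu mu' : probability X R) (m m' : set X -> \bar R)
    (r r' : R) :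
  0 < kernel_update mu setT < +oo -> 0 < kernel_update mu' setT < +oo ->
  (forall A, measurable A -> m A = kernel_posterior mu A) ->
  (forall A, measurable A -> m' A = kernel_posterior mu' A) ->
  is_dTV m m' r -> is_dTV mu mu' r' ->
  (r <= C / fine (kernel_update mu setT) * r')%R.
Proof.
move=> /evidence_gt0[Z Zp ZE] /evidence_gt0[Z' Zp' ZE'] mE m'E mr mr'.
have updfin (nu : probability X R) A z : kernel_update nu setT = z%:E -> measurable A ->
    exists2 a, (0 <= a <= z)%R & kernel_update nu A = a%:E.
  move=> zE mA; have a0 : 0 <= kernel_update nu A.
    by apply: integral_ge0 => x _; exact: kernel_int_ge0.
  have az : kernel_update nu A <= z%:E.
    rewrite -zE; apply: ge0_le_integral_nonmeasurable => x.
      exact: kernel_int_ge0.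
    by have [] := kernel_int_indic_fin x mA.
  exists (fine (kernel_update nu A)); last first.
    by rewrite fineK// ge0_fin_numE//; exact: le_lt_trans az (ltry _).
  rewrite -!lee_fin fineK ?a0//.
  by rewrite ge0_fin_numE//; exact: le_lt_trans az (ltry _).
have m1 : m setT = 1.
  by rewrite mE// /kernel_posterior ZE -EFinM/= divff// gt_eqF.
have m'1 : m' setT = 1.
  by rewrite m'E// /kernel_posterior ZE' -EFinM/= divff// gt_eqF.
have [A mA] := is_dTV_witness m1 m'1 mr.
have [a _ aE] := updfin mu A Z ZE mA.
have [a' /andP[a'0 a'Z] a'E] := updfin mu' A Z' ZE' mA.
rewrite mE// m'E// /kernel_posterior ZE ZE' aE a'E/= -!EFinM -EFinD => -[rE].
pose u x := fine (kernel_int \1_A x); pose v x := fine (kernel_int \1_setT x).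
have uE x : (u x)%:E = kernel_int \1_A x.
  by rewrite fineK//; have [] := kernel_int_indic_fin x mA.
have vE x : (v x)%:E = kernel_int \1_setT x.
  by rewrite fineK//; have [] := kernel_int_indic_fin x (@measurableT _ X).
have mIA : measurable_fun setT (\1_A : X -> R) by exact: measurable_indic.
have mu_ : measurable_fun setT u.
  by apply/measurable_EFinP; rewrite [X in measurable_fun _ X](_ : _ = kernel_int \1_A);
    [exact: measurable_kernel_int|exact/funext/uE].
have mv : measurable_fun setT v.
  by apply/measurable_EFinP; rewrite [X in measurable_fun _ X](_ : _ = kernel_int \1_setT);
    [exact: measurable_kernel_int|exact/funext/vE].
have iu (nu : probability X R) : \int[nu]_x (u x)%:E = kernel_update nu A.
  by apply: eq_integral => x _; exact: uE.
have iv (nu : probability X R) : \int[nu]_x (v x)%:E = kernel_update nu setT.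
  by apply: eq_integral => x _; exact: vE.
(* The choice [c = a' / Z'], the posterior mass of [A] from [mu'], makes [u - c v] integrate to 0
   against [mu']. Its integral against [mu] is [a - c Z = Z r], so only the evidence of [mu] remains
   in the bound. *)
have := @is_dTV_test _ _ _ mu mu' r' C (a' / Z') u v mr' mu_ mv; rewrite !iu !iv.
rewrite ZE ZE' aE a'E -!EFinM -!EFinD lee_fin.
have -> : (a' / Z' * Z' = a')%R by rewrite divfK// gt_eqF.
move=> H.
have {}H : (a + a' <= a' + a' / Z' * Z + C * r')%R.
  apply: H.
  - by move=> x; rewrite -!lee_fin uE vE; have [-> ->] := kernel_int_indic_fin x mA.
  - by move=> x; rewrite -!lee_fin vE; have [] := kernel_int_indic_fin x mA.
  - by rewrite divr_ge0 ?(ltW Zp')//= ler_pdivrMr// mul1r.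
have -> : r = (a / Z - a' / Z')%R by rewrite -rE addrK.
rewrite mulrAC ler_pdivlMr// mulrBl divfK ?gt_eqF//.
by lra.
Qed.

End kernel_update.

(** * The Hellinger bound for kernel updates *)

Section kernel_hellinger.
Context {R : realType} {dE dX : measure_display} {E : measurableType dE}
  {X : measurableType dX}.
Variables (rho : {sigma_finite_measure set E -> \bar R}) (q : E -> X -> R)
  (th : E -> X -> X).
Local Open Scope ereal_scope.
Local Notation kernel_int := (kernel_int rho q th).
Local Notation kernel_update := (kernel_update rho q th).
Local Notation kernel_posterior := (kernel_posterior rho q th).
Hypothesis mq : measurable_fun setT (fun z : E * X => q z.1 z.2).
Hypothesis q0 : forall e x, (0 <= q e x)%R.
Hypothesis mth : measurable_fun setT (fun z : E * X => th z.1 z.2).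

Variable C : R.
Hypothesis qC : forall x, \int[rho]_e (q e x)%:E <= C%:E.

(** [hellinger_le_test] is applied to the prior densities at [x] with test value [t (th e x)],
    weighted by [q e x], and integrated in [e] and [x]. The square does not depend on [e], so its
    weight is at most [C]. *)
Lemma kernel_hellinger_test (mu mu' : probability X R) (r : R) (t : X -> R) :
  is_dH mu mu' r -> measurable_fun setT t -> (forall x, (0 < t x)%R) ->
  measurable_fun setT (fun x => (t x)^-1)%R ->
  kernel_update mu setT + kernel_update mu' setT <=
  (2 * C * r ^+ 2)%:E + \int[mu]_x kernel_int t x +
    \int[mu']_x kernel_int (fun x => (t x)^-1)%R x.
Proof.
move=> [nu [f [f' [dm dm' r0 rE]]]] mt t0 mti.
have [[_ mf f0 _] [_ mf' f'0 _]] := (dm, dm').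
have t1 x : (0 <= t x)%R by exact: ltW.
have ti0 x : (0 <= (t x)^-1)%R by rewrite invr_ge0.
have mI : measurable_fun setT (\1_setT : X -> R) by exact: measurable_indic.
have kge (s : X -> R) x : (forall x, 0 <= s x)%R -> 0 <= kernel_int s x.
  by move=> s0; exact: kernel_int_ge0.
have mk (s : X -> R) : measurable_fun setT s -> (forall x, 0 <= s x)%R ->
    measurable_fun setT (kernel_int s).
  by move=> ms s0; exact: measurable_kernel_int.
have I0 (x : X) : (0 <= (\1_[set: X] x : R))%R by [].
have C0 : (0 <= C)%R.
  by rewrite -lee_fin; apply: le_trans (qC point); apply: integral_ge0 => e _; rewrite lee_fin.
have mh := measurable_sqrt_diff mf mf'.
have -> : (2 * C * r ^+ 2)%:E =
    \int[nu]_x (C * (Num.sqrt (f x) - Num.sqrt (f' x)) ^+ 2)%:E.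
  rewrite ge0_integralM_EFin//; last by move=> x; exact: sqr_ge0.
  by rewrite -mulrA mulrCA 2!EFinM rE (muleA 2%:E) -EFinM divff// mul1e.
rewrite /kernel_update !(ge0_integral_density dm)//;
  try by [move=> x; exact: kge|exact: mk].
rewrite !(ge0_integral_density dm')//; try by [move=> x; exact: kge|exact: mk].
have mke (h s : X -> R) : measurable_fun setT h -> measurable_fun setT s ->
    (forall x, 0 <= s x)%R ->
    measurable_fun setT (fun x => (h x)%:E * kernel_int s x).
  by move=> mh' ms s0; apply: emeasurable_funM; [exact/measurable_EFinP|exact: mk].
have ge (h s : X -> R) x : (forall x, 0 <= h x)%R -> (forall x, 0 <= s x)%R ->
    0 <= (h x)%:E * kernel_int s x.
  by move=> h0 s0; rewrite mule_ge0 ?lee_fin// kge.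
have mhC : measurable_fun setT (fun x => (C * (Num.sqrt (f x) - Num.sqrt (f' x)) ^+ 2)%:E).
  by apply/measurable_EFinP; exact: measurable_funM.
rewrite -!ge0_integralD//; try by [move=> x _; exact: ge|exact: mke
  |move=> x _; rewrite lee_fin mulr_ge0 ?sqr_ge0
  |move=> x _; rewrite adde_ge0 ?ge// lee_fin mulr_ge0 ?sqr_ge0
  |apply: emeasurable_funD => //; exact: mke].
apply: ge0_le_integral_nonmeasurable => x; first by rewrite adde_ge0// ge.
have mqx : measurable_fun setT (q ^~ x) by exact: measurable_kernel_section.
have mqt (s : X -> R) : measurable_fun setT s ->
    measurable_fun setT (fun e => q e x * s (th e x))%R.
  move=> ms; apply: measurable_funM => //; apply: measurableT_comp ms _.
  exact: measurable_kernel_point.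
have lin (h s : X -> R) : (forall x, 0 <= h x)%R -> (forall x, 0 <= s x)%R ->
    measurable_fun setT s ->
    (h x)%:E * kernel_int s x = \int[rho]_e (h x * (q e x * s (th e x)))%:E.
  move=> h0 s0 ms; rewrite ge0_integralM_EFin//; first exact: mqt.
  by move=> e; rewrite mulr_ge0.
rewrite !lin//.
apply: (@le_trans _ _ (\int[rho]_e (q e x * (Num.sqrt (f x) - Num.sqrt (f' x)) ^+ 2)%:E +
   \int[rho]_e (f x * (q e x * t (th e x)))%:E +
   \int[rho]_e (f' x * (q e x * (t (th e x))^-1))%:E)).
  have P (h s : X -> R) : (forall x, 0 <= h x)%R -> (forall x, 0 <= s x)%R ->
      forall e, (0 <= h x * (q e x * s (th e x)))%R.
    by move=> h0 s0 e; rewrite !mulr_ge0.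
  have M (h s : X -> R) : measurable_fun setT s ->
      measurable_fun setT (fun e => (h x : R) * (q e x * s (th e x)))%R.
    by move=> ms; apply: measurable_funM => //; exact: mqt.
  have P1 e : (0 <= q e x * (Num.sqrt (f x) - Num.sqrt (f' x)) ^+ 2)%R.
    by rewrite mulr_ge0 ?sqr_ge0.
  have M1 : measurable_fun setT
      (fun e => q e x * (Num.sqrt (f x) - Num.sqrt (f' x)) ^+ 2)%R.
    exact: measurable_funM.
  have := P _ _ f'0 ti0; have := P _ _ f0 t1; have := M f' _ mti; have := M f _ mt.
  move=> M2 M3 P2 P3; have := P _ \1_[set: X] f'0 I0; have := P _ \1_[set: X] f0 I0.
  have := M f' _ mI; have := M f _ mI => M4 M5 P4 P5.
  rewrite -!ge0_integralD_EFin//; try by [apply: measurable_funD|move=> e; apply: addr_ge0].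
  apply: ge0_le_integral_nonmeasurable => e; rewrite lee_fin; first by rewrite addr_ge0 ?P.
  rewrite !indicT !mulr1.
  have := ler_wpM2l (q0 e x) (hellinger_le_test (f0 x) (f'0 x) (t0 (th e x))).
  by rewrite !mulrDr; lra.
apply: leeD => //; apply: leeD => //.
under eq_integral do rewrite mulrC.
rewrite ge0_integralM_EFin ?sqr_ge0// muleC (EFinM C); apply: lee_wpmul2r => //.
by rewrite lee_fin sqr_ge0.
Qed.

Theorem kernel_posterior_dH (mu mu' : probability X R) (m m' : set X -> \bar R)
    (r r' : R) :
  0 < kernel_update mu setT < +oo -> 0 < kernel_update mu' setT < +oo ->
  (forall A, measurable A -> m A = kernel_posterior mu A) ->
  (forall A, measurable A -> m' A = kernel_posterior mu' A) ->
  is_dH m m' r -> is_dH mu mu' r' ->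
  (r <= 2 * Num.sqrt (C / fine (kernel_update mu setT)) * r')%R.
Proof.
move=> /evidence_gt0[Z Z0 ZE] /evidence_gt0[Z' Z'0 Z'E] mE m'E.
move=> [nu [g [g' [dm dm' r0 rE]]]] mr'.
have r'0 : (0 <= r')%R by case: mr' => [? [? [? []]]].
have [[snu mg g0 mgE] [_ mg' g'0 m'gE]] := (dm, dm').
have g1 : \int[nu]_x (g x)%:E = 1.
  by rewrite -(dens_rep_setT dm) mE// /kernel_posterior ZE -EFinM divff// gt_eqF.
have g'1 : \int[nu]_x (g' x)%:E = 1.
  by rewrite -(dens_rep_setT dm') m'E// /kernel_posterior Z'E -EFinM divff// gt_eqF.
have mgg := measurable_sqrt_diff mg mg'.
have sqrE : \int[nu]_x ((Num.sqrt (g x) - Num.sqrt (g' x)) ^+ 2)%:E = (2 * r ^+ 2)%:E.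
  by rewrite EFinM rE muleA -EFinM divff// mul1e.
have s2 : (2 * r ^+ 2 <= 2)%R.
  rewrite -lee_fin -sqrE; apply: (@le_trans _ _ (\int[nu]_x (g x + g' x)%:E)).
    apply: ge0_le_integral_nonmeasurable => x; rewrite lee_fin ?sqr_ge0//.
    rewrite sqrrB !sqr_sqrtr// addrAC lerBlDr addrC lerDl.
    by rewrite mulrn_wge0// mulr_ge0 ?sqrtr_ge0.
  by rewrite ge0_integralD_EFin// g1 g'1 -EFinD.
(* If [h] is the density of a posterior and [ka] its evidence, [ka h] is the density of the
   unnormalized update, so tests on the posterior side become kernel integrals over the prior. *)
have post (ka : R) (la : probability X R) (l : set X -> \bar R) (h t : X -> R) :
    (0 < ka)%R -> kernel_update la setT = ka%:E -> dens_rep nu h l ->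
    (forall A, measurable A -> l A = kernel_posterior la A) ->
    measurable_fun setT t -> (forall x, 0 <= t x)%R ->
    \int[nu]_x (t x * (ka * h x))%:E = \int[la]_x kernel_int t x.
  move=> ka0 kaE dh lE mt t0; have [_ mh h0 hE] := dh.
  have [M ME] := pushforward_density_exists nu mh h0 (@measurable_id _ X setT).
  have dM : dens_rep nu h M by split=> //.
  have MU A : measurable A -> M A = (ka^-1)%:E * kernel_update la A.
    by move=> mA; rewrite ME preimage_id -hE// lE// /kernel_posterior kaE/= muleC.
  have := integral_kernel_update mq q0 mth (k := ka^-1) _ MU mt t0.
  rewrite (ge0_integral_density dM)//; last exact/measurable_EFinP.
  rewrite invr_ge0 ltW// => /(_ isT) /(congr1 (mule ka%:E)).
  rewrite muleA -EFinM divff ?gt_eqF// mul1e => <-.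
  under [in RHS]eq_integral do rewrite -EFinM.
  rewrite -ge0_integralM_EFin ?(ltW ka0)//; last 2 first.
  - exact: measurable_funM.
  - by move=> x; rewrite mulr_ge0.
  by apply: eq_integral => x _; congr EFin; ring.
(* The left side is the integral of [(sqrt (Z g) - sqrt (Z' g'))^2], expressed through [r] since
   [r^2] is 1 minus the integral of [sqrt (g g')]. This is the unnormalized bound up to the error of
   the test function. *)
have key (e : R) : (0 < e)%R ->
    (Z + Z' - 2 * (Num.sqrt Z * Num.sqrt Z') + 2 * (Num.sqrt Z * Num.sqrt Z') * r ^+ 2
     <= 2 * C * r' ^+ 2 + e * (Z + Z'))%R.
  move=> e0; set a := Num.sqrt Z; set b := Num.sqrt Z'.
  have ab0 : (0 <= a * b)%R by rewrite mulr_ge0 ?sqrtr_ge0.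
  have aa : (a ^+ 2 = Z)%R by rewrite sqr_sqrtr// ltW.
  have bb : (b ^+ 2 = Z')%R by rewrite sqr_sqrtr// ltW.
  have Zg0 x : (0 <= Z * g x)%R by rewrite mulr_ge0// ltW.
  have Zg'0 x : (0 <= Z' * g' x)%R by rewrite mulr_ge0// ltW.
  have mZg : measurable_fun setT (fun x => Z * g x)%R by exact: measurable_funM.
  have mZg' : measurable_fun setT (fun x => Z' * g' x)%R by exact: measurable_funM.
  have [t [mt t0 tle]] := hellinger_witness mZg mZg' Zg0 Zg'0 e0.
  have mti := measurable_fun_inv_gt0 mt t0.
  have t1 x : (0 <= t x)%R by exact: ltW.
  have ti1 x : (0 <= (t x)^-1)%R by rewrite invr_ge0.
  have H2 := kernel_hellinger_test mr' mt t0 mti.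
  rewrite -(post _ _ _ _ _ Z0 ZE dm mE mt t1) in H2.
  rewrite -(post _ _ _ _ _ Z'0 Z'E dm' m'E mti ti1) ZE Z'E in H2.
  set I := \int[nu]_x (t x * _)%:E in H2.
  set I' := \int[nu]_x ((t x)^-1 * _)%:E in H2.
  have I0 : 0 <= I by apply: integral_ge0 => x _; rewrite lee_fin mulr_ge0.
  have I'0 : 0 <= I' by apply: integral_ge0 => x _; rewrite lee_fin mulr_ge0.
  have c0 x : (0 <= a * b * (Num.sqrt (g x) - Num.sqrt (g' x)) ^+ 2)%R.
    by rewrite mulr_ge0 ?sqr_ge0.
  have mc : measurable_fun setT (fun x => a * b * (Num.sqrt (g x) - Num.sqrt (g' x)) ^+ 2)%R.
    exact: measurable_funM.
  have mtZ : measurable_fun setT (fun x => t x * (Z * g x))%R by exact: measurable_funM.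
  have mtZ' : measurable_fun setT (fun x => (t x)^-1 * (Z' * g' x))%R by exact: measurable_funM.
  have tZ0 x : (0 <= t x * (Z * g x))%R by rewrite mulr_ge0.
  have tZ'0 x : (0 <= (t x)^-1 * (Z' * g' x))%R by rewrite mulr_ge0.
  (* Rests on [(sqrt (Z g) - sqrt (Z' g'))^2 + a b (g + g') = Z g + Z' g' + a b (sqrt g - sqrt
     g')^2], which replaces the mixed term [sqrt (g g')] by the square defining [r]. *)
  have H1 : (Z + Z' + a * b * (2 * r ^+ 2))%:E + I + I' <=
      ((1 + e) * (Z + Z') + a * b * 2)%:E.
    have -> : (Z + Z' + a * b * (2 * r ^+ 2))%:E = \int[nu]_x (Z * g x + Z' * g' x +
        a * b * (Num.sqrt (g x) - Num.sqrt (g' x)) ^+ 2)%:E.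
      rewrite ge0_integralD_EFin//; [|exact: measurable_funD|by move=> x; rewrite addr_ge0].
      rewrite ge0_integralD_EFin// !ge0_integralM_EFin ?(ltW Z0) ?(ltW Z'0)//; last first.
        by move=> x; exact: sqr_ge0.
      by rewrite g1 g'1 sqrE !mule1.
    have -> : ((1 + e) * (Z + Z') + a * b * 2)%:E =
        \int[nu]_x ((1 + e) * (Z * g x + Z' * g' x) + a * b * (g x + g' x))%:E.
      have e1 : (0 <= 1 + e)%R by rewrite addr_ge0// ltW.
      have mZ : measurable_fun setT (fun x => Z * g x + Z' * g' x)%R by exact: measurable_funD.
      have mG : measurable_fun setT (fun x => g x + g' x)%R by exact: measurable_funD.
      have Z1 x : (0 <= Z * g x + Z' * g' x)%R by rewrite addr_ge0.
      have G1 x : (0 <= g x + g' x)%R by rewrite addr_ge0.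
      rewrite ge0_integralD_EFin//; try by [exact: measurable_funM|move=> x; rewrite mulr_ge0].
      rewrite !ge0_integralM_EFin//.
      rewrite !ge0_integralD_EFin// !ge0_integralM_EFin ?(ltW Z0) ?(ltW Z'0)//.
      rewrite g1 g'1 !mule1. by rewrite (EFinD (_ * _)) (EFinM (1 + e)) (EFinD Z) (EFinM (a * b)).
    rewrite -!ge0_integralD_EFin//; try by [repeat apply: measurable_funD
      |move=> x; rewrite ?addr_ge0].
    apply: ge0_le_integral_nonmeasurable => x; rewrite lee_fin ?addr_ge0//.
    have := tle x; rewrite !sqrtrM ?(ltW Z0) ?(ltW Z'0)// -/a -/b -aa -bb.
    have := sqr_sqrtr (g0 x); have := sqr_sqrtr (g'0 x).
    set u := Num.sqrt (g x); set v := Num.sqrt (g' x) => <- <-.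
    by lra.
  (* [H1] bounds the nonnegative [I] and [I'] by a real number; being finite, they can be eliminated
     between [H1] and [H2]. *)
  have fin J K L : 0 <= J -> 0 <= K -> L%:E + J + K <= ((1 + e) * (Z + Z') + a * b * 2)%:E ->
      J \is a fin_num /\ K \is a fin_num.
    by case: J => [J| |]//; case: K => [K| |].
  have [If I'f] := fin _ _ _ I0 I'0 H1.
  move: H1 H2; rewrite -(fineK If) -(fineK I'f) -!EFinD !lee_fin.
  by lra.
have {}key : (Z + Z' - 2 * (Num.sqrt Z * Num.sqrt Z') + 2 * (Num.sqrt Z * Num.sqrt Z') * r ^+ 2
     <= 2 * C * r' ^+ 2)%R.
  apply/ler_addgt0Pr => e e0; have ZZ : (0 < Z + Z')%R by rewrite addr_gt0.
  by have := key (e / (Z + Z'))%R (divr_gt0 e0 ZZ); rewrite divfK// gt_eqF.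
have C0 : (0 <= C)%R.
  by rewrite -lee_fin; apply: le_trans (qC point); apply: integral_ge0 => e _; rewrite lee_fin.
have sZ : (0 < Num.sqrt Z)%R by rewrite sqrtr_gt0.
have sZ' : (0 < Num.sqrt Z')%R by rewrite sqrtr_gt0.
(* With [s = 2 r^2] the bracket on the right is the left side of [key], at most [2 C r'^2]. Hence
   [Z r^2 <= 4 C r'^2], whose root gives the factor 2. *)
have := @hellinger_normalization _ _ _ (2 * r ^+ 2) sZ sZ'.
rewrite s2 mulr_ge0 ?sqr_ge0// => /(_ isT) H.
have {}H : (Z * r ^+ 2 <= 4 * C * r' ^+ 2)%R.
  move: H key; have := sqr_sqrtr (ltW Z0); have := sqr_sqrtr (ltW Z'0).
  by set a := Num.sqrt Z; set b := Num.sqrt Z' => <- <-; lra.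
rewrite ZE/= -(@ler_sqr R) ?nnegrE//; last by rewrite !mulr_ge0 ?sqrtr_ge0.
rewrite !exprMn sqr_sqrtr ?divr_ge0 ?(ltW Z0)//.
have -> : (2 ^+ 2 * (C / Z) * r' ^+ 2 = 4 * C * r' ^+ 2 / Z)%R by field; rewrite gt_eqF.
by rewrite ler_pdivlMr// mulrC.
Qed.

End kernel_hellinger.

(** * Wasserstein distance *)

Section overlap_coupling.
Context {R : realType} {dO dX : measure_display} {O : measurableType dO}
  {X : measurableType dX}.
Local Open Scope ereal_scope.

Lemma W1_le_cost (dist : X -> X -> R) (m m' : set X -> \bar R)
    (g : probability (X * X)%type R) : coupling g m m' ->
  W1 dist m m' <= \int[g]_z (dist z.1 z.2)%:E.
Proof. by move=> mm'; apply: ereal_inf_lbound; exists g. Qed.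

(* The common part [c] of the densities is moved along [(s, s')]; the two
   residuals, of equal mass [l], are coupled independently. *)
Lemma W1_le_overlap (P : {measure set O -> \bar R}) (s s' : O -> X)
    (p p' c : O -> R) (l D : R) (dist : X -> X -> R) (m m' : set X -> \bar R)
    (P0 : probability X R) :
  measurable_fun setT s -> measurable_fun setT s' ->
  measurable_fun setT p -> measurable_fun setT p' -> measurable_fun setT c ->
  (forall w, (0 <= c w)%R) -> (forall w, (c w <= p w)%R) -> (forall w, (c w <= p' w)%R) ->
  measurable_fun setT (fun z : X * X => dist z.1 z.2) ->
  (forall x y, (0 <= dist x y <= D)%R) ->
  (forall A, measurable A -> m A = \int[P]_w (p w * \1_A (s w))%:E) ->
  (forall A, measurable A -> m' A = \int[P]_w (p' w * \1_A (s' w))%:E) ->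
  m setT = 1 -> m' setT = 1 ->
  \int[P]_w (p w - c w)%:E = l%:E ->
  W1 dist m m' <= \int[P]_w (c w * dist (s w) (s' w))%:E + (D * l)%:E.
Proof.
move=> ms ms' mp mp' mc c0 cp cp' mdist distD mE m'E m1 m'1 lE.
have d0 x y : (0 <= dist x y)%R by have /andP[] := distD x y.
have mss : measurable_fun setT (fun w => (s w, s' w)) by exact/measurable_fun_pairP.
have pc0 w : (0 <= p w - c w)%R by rewrite subr_ge0.
have pc'0 w : (0 <= p' w - c w)%R by rewrite subr_ge0.
have mpc : measurable_fun setT (fun w => p w - c w)%R by exact: measurable_funB.
have mpc' : measurable_fun setT (fun w => p' w - c w)%R by exact: measurable_funB.
have ind (Y : measurableType dX) (A : set Y) (t : O -> Y) : measurable A ->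
    measurable_fun setT t -> measurable_fun setT (fun w => \1_A (t w) : R).
  by move=> mA mt; apply: measurableT_comp mt; exact: measurable_indic.
have split_mass (f : O -> R) (t : O -> X) A : measurable_fun setT f ->
    (forall w, (c w <= f w)%R) -> measurable_fun setT t -> measurable A ->
    \int[P]_w (c w * \1_A (t w))%:E + \int[P]_w ((f w - c w) * \1_A (t w))%:E =
    \int[P]_w (f w * \1_A (t w))%:E.
  move=> mf cf mt mA; rewrite -ge0_integralD_EFin//.
  - by apply: eq_integral => w _; congr EFin; ring.
  - by apply: measurable_funM => //; exact: ind.
  - by apply: measurable_funM; [exact: measurable_funB|exact: ind].
  - by move=> w; rewrite mulr_ge0.
  - by move=> w; rewrite mulr_ge0// subr_ge0.
have [G GE] := pushforward_density_exists P mc c0 mss.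
have [a aE] := pushforward_density_exists P mpc pc0 ms.
have [a' a'E] := pushforward_density_exists P mpc' pc'0 ms'.
have aI A : a A = \int[P]_w ((p w - c w) * \1_A (s w))%:E.
  by rewrite aE integral_indicr.
have a'I A : a' A = \int[P]_w ((p' w - c w) * \1_A (s' w))%:E.
  by rewrite a'E integral_indicr.
have aT : a setT = l%:E by rewrite aE preimage_setT.
have G1 A : G (A `*` setT) = \int[P]_w (c w * \1_A (s w))%:E.
  rewrite GE (_ : _ @^-1` _ = s @^-1` A); first exact: integral_indicr.
  by apply/seteqP; split=> w //= [].
have G2 A : G (setT `*` A) = \int[P]_w (c w * \1_A (s' w))%:E.
  rewrite GE (_ : _ @^-1` _ = s' @^-1` A); first exact: integral_indicr.
  by apply/seteqP; split=> w //= [].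
have mass1 A : measurable A -> G (A `*` setT) + a A = m A.
  by move=> mA; rewrite G1 aI mE// split_mass.
have mass2 A : measurable A -> G (setT `*` A) + a' A = m' A.
  by move=> mA; rewrite G2 a'I m'E// split_mass.
(* The residuals have equal mass because [m] and [m'] both have mass 1 and share the part [G]. *)
have a'T : a' setT = l%:E.
  have := mass1 setT measurableT; have := mass2 setT measurableT.
  rewrite setXTT aT m1 m'1; have : 0 <= G setT by [].
  case: (G setT) => [x| |]//; case: (a' setT) => [y| |]// _.
  by rewrite -!EFinD => -[h1] -[h2]; congr EFin; lra.
have l0 : (0 <= l)%R by rewrite -lee_fin -aT.
(* Normalizing one factor makes [a \x N] a measure with marginals [a] and [a']. If [l = 0],
   normalization falls back on [P0], and both residuals are null. *)
pose N := mnormalize a' P0.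
have aN A : measurable A -> a setT * N A = a' A.
  move=> mA; rewrite /N /mnormalize/= aT a'T; have [l00|lN0] := eqVneq l 0%R.
    rewrite l00 eqxx/= mul0e; apply/esym/eqP; rewrite -measure_le0.
    apply: (@le_trans _ _ (a' setT)); last by rewrite a'T l00.
    by apply: le_measure; rewrite ?inE.
  by rewrite eqe (negbTE lN0)/= muleCA -EFinM divff// mule1.
pose g0 : {measure set (X * X) -> \bar R} := measure_add G (a \x N).
have g0E A : g0 A = G A + (a \x N) A by exact: (measure_addE G (a \x N)).
have aNE A B : measurable A -> measurable B -> (a \x N) (A `*` B) = a A * N B.
  by move=> mA mB; rewrite product_measure1E.
have NT : N setT = 1 by exact: probability_setT.
have g0T : g0 setT = 1 by rewrite g0E -setXTT aNE// NT mule1 mass1.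
pose M := Measure_isProbability.Build _ _ _ g0 g0T.
pose g : probability (X * X)%type R := HB.pack (Measure.sort g0) M.
have gC : coupling g m m'.
  by move=> A mA; rewrite /g/= !g0E !aNE// NT mule1 mass1// aN// mass2.
apply: (le_trans (W1_le_cost dist gC)).
rewrite [leLHS](_ : _ = \int[G]_z (dist z.1 z.2)%:E + \int[a \x N]_z (dist z.1 z.2)%:E); last first.
  rewrite /g/= ge0_integral_measure_add//.
  - by move=> z _; rewrite lee_fin.
  - exact/measurable_EFinP.
(* The part [G] costs the integral of [c dist] along [(s, s')]; the independent part has mass [l]
   and costs at most [D] per unit. *)
apply: leeD.
  rewrite (ge0_integral_pushforward_density (P := P) (b := c) (th := fun w => (s w, s' w)))//.
  - by move=> A mA; rewrite GE integral_indicr.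
  - exact/measurable_EFinP.
  - by move=> z; rewrite lee_fin.
apply: (@le_trans _ _ (\int[a \x N]_z D%:E)).
  apply: ge0_le_integral_nonmeasurable => z; rewrite lee_fin//.
  by have /andP[] := distD z.1 z.2.
by rewrite integral_cst// -[X in _ * X]/((a \x N) setT) -setXTT aNE// NT mule1 aT EFinM.
Qed.

End overlap_coupling.

(** * The Wasserstein bound for kernel updates *)

Section kernel_wasserstein.
Context {R : realType} {dE dX : measure_display} {E : measurableType dE}
  {X : measurableType dX}.
Variables (rho : {sigma_finite_measure set E -> \bar R}) (q : E -> X -> R)
  (th : E -> X -> X).
Local Open Scope ereal_scope.
Local Notation kernel_int := (kernel_int rho q th).
Local Notation kernel_update := (kernel_update rho q th).
Local Notation kernel_posterior := (kernel_posterior rho q th).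
Hypothesis mq : measurable_fun setT (fun z : E * X => q z.1 z.2).
Hypothesis q0 : forall e x, (0 <= q e x)%R.
Hypothesis mth : measurable_fun setT (fun z : E * X => th z.1 z.2).
Variables (dist : X -> X -> R) (D B L : R).
Hypothesis mdist : measurable_fun setT (fun z : X * X => dist z.1 z.2).
Hypothesis distD : forall x y, (0 <= dist x y <= D)%R.
Hypothesis B0 : (0 <= B)%R.
Hypothesis L0 : (0 <= L)%R.
Hypothesis hB : forall x x',
  \int[rho]_e (q e x * dist (th e x) (th e x'))%:E <= (B * dist x x')%:E.
Hypothesis hL : forall x x',
  \int[rho]_e (`|q e x - q e x'|)%:E <= (L * dist x x')%:E.

Lemma integral_coupling (mu mu' : probability X R) (g : probability (X * X)%type R)
    (t : X -> \bar R) : coupling g mu mu' -> measurable_fun setT t -> (forall x, 0 <= t x) ->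
  \int[g]_z t z.1 = \int[mu]_x t x /\ \int[g]_z t z.2 = \int[mu']_x t x.
Proof.
move=> gC mt t0.
have push (pr : X * X -> X) (nu : probability X R) : measurable_fun setT pr ->
    (forall A, measurable A -> nu A = g (pr @^-1` A)) ->
    \int[g]_z t (pr z) = \int[nu]_x t x.
  move=> mpr nuE; rewrite (ge0_integral_pushforward_density (P := g) (b := cst 1%R) (th := pr))//.
  - by apply: eq_integral => z _; rewrite mul1e.
  - move=> A mA; transitivity (g (pr @^-1` A)); first exact: nuE.
    have mpA : measurable (pr @^-1` A) by rewrite -[X in measurable X]setTI; exact: mpr.
    have := integral_indic g measurableT mpA; rewrite setIT => <-.
    by apply: eq_integral => z _; rewrite mul1r.
split; apply: push => //.
- move=> A mA; have [<- _] := gC A mA; congr (g _).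
  by apply/seteqP; split=> z //= [].
- move=> A mA; have [_ <-] := gC A mA; congr (g _).
  by apply/seteqP; split=> z //= [].
Qed.

(** [B] pays for moving the common mass from [th e x] to [th e x'], and [D L] for the mass left over
    where the weights [q e x] and [q e x'] differ. *)
Lemma kernel_posterior_coupling (mu mu' : probability X R) (m m' : set X -> \bar R)
    (g : probability (X * X)%type R) :
  0 < kernel_update mu setT < +oo -> 0 < kernel_update mu' setT < +oo ->
  (forall A, measurable A -> m A = kernel_posterior mu A) ->
  (forall A, measurable A -> m' A = kernel_posterior mu' A) ->
  coupling g mu mu' ->
  W1 dist m m' <= ((D * L + B) / fine (kernel_update mu setT))%:E *
    \int[g]_z (dist z.1 z.2)%:E.
Proof.
move=> /evidence_gt0[Z Z0 ZE] /evidence_gt0[Z' Z'0 Z'E] mE m'E gC; rewrite ZE/=.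
have d0 x y : (0 <= dist x y)%R by have /andP[] := distD x y.
have D0 : (0 <= D)%R by have /andP[h1 h2] := distD point point; exact: le_trans h2.
(* Dividing by the larger evidence keeps [min (q1, q2) / M] below both posterior densities [q1 / Z]
   and [q2 / Z']. *)
pose M := Order.max Z Z'.
have M0 : (0 < M)%R by rewrite lt_max Z0.
have [MZ MZ'] : (Z <= M)%R /\ (Z' <= M)%R by rewrite !le_max !lexx orbT.
pose P := (rho \x g).
have mp1 : measurable_fun setT (fun w : E * (X * X) => (w.1, w.2.1)).
  by apply: measurable_fun_pair => //; exact: (measurableT_comp measurable_fst measurable_snd).
have mp2 : measurable_fun setT (fun w : E * (X * X) => (w.1, w.2.2)).
  by apply: measurable_fun_pair => //; exact: (measurableT_comp measurable_snd measurable_snd).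
pose q1 (w : E * (X * X)) := q w.1 w.2.1; pose q2 (w : E * (X * X)) := q w.1 w.2.2.
pose s1 (w : E * (X * X)) := th w.1 w.2.1; pose s2 (w : E * (X * X)) := th w.1 w.2.2.
have mq1 : measurable_fun setT q1 by exact: measurableT_comp mq mp1.
have mq2 : measurable_fun setT q2 by exact: measurableT_comp mq mp2.
have ms1 : measurable_fun setT s1 by exact: measurableT_comp mth mp1.
have ms2 : measurable_fun setT s2 by exact: measurableT_comp mth mp2.
have mI A : measurable A -> measurable_fun setT (\1_A : X -> R).
  by move=> mA; exact: measurable_indic.
have fub (f : E * (X * X) -> R) : measurable_fun setT f -> (forall w, 0 <= f w)%R ->
    \int[P]_w (f w)%:E = \int[g]_z \int[rho]_e (f (e, z))%:E.
  move=> mf f0; rewrite /P (fubini_tonelli2 (EFin \o f))//.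
  exact/measurable_EFinP.
have marg1 (A : set X) : measurable A ->
    \int[P]_w (q1 w * \1_A (s1 w))%:E = kernel_update mu A.
  move=> mA; have mk : measurable_fun setT (kernel_int \1_A).
    by apply: measurable_kernel_int => //; exact: mI.
  have k0 x : 0 <= kernel_int \1_A x by exact: kernel_int_ge0.
  rewrite /kernel_update; have [<- _] := integral_coupling gC mk k0.
  rewrite fub//; last by move=> w; rewrite mulr_ge0// /q1.
  by apply: measurable_funM => //; apply: measurableT_comp ms1; exact: mI.
have marg2 (A : set X) : measurable A ->
    \int[P]_w (q2 w * \1_A (s2 w))%:E = kernel_update mu' A.
  move=> mA; have mk : measurable_fun setT (kernel_int \1_A).
    by apply: measurable_kernel_int => //; exact: mI.
  have k0 x : 0 <= kernel_int \1_A x by exact: kernel_int_ge0.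
  rewrite /kernel_update; have [_ <-] := integral_coupling gC mk k0.
  rewrite fub//; last by move=> w; rewrite mulr_ge0// /q2.
  by apply: measurable_funM => //; apply: measurableT_comp ms2; exact: mI.
pose p w := (Z^-1 * q1 w)%R; pose p' w := (Z'^-1 * q2 w)%R.
pose c w := (M^-1 * Order.min (q1 w) (q2 w))%R.
have mp : measurable_fun setT p by exact: measurable_funM.
have mp' : measurable_fun setT p' by exact: measurable_funM.
have mmin : measurable_fun setT (fun w => Order.min (q1 w) (q2 w)).
  exact: measurable_minr.
have mc : measurable_fun setT c by exact: measurable_funM.
have min0 w : (0 <= Order.min (q1 w) (q2 w))%R by rewrite le_min !q0.
have c0 w : (0 <= c w)%R by rewrite mulr_ge0// invr_ge0 ltW.
have cp w : (c w <= p w)%R.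
  by apply: ler_pM => //; rewrite ?invr_ge0 ?(ltW M0)// ?ge_min ?lexx// lef_pV2.
have cp' w : (c w <= p' w)%R.
  by apply: ler_pM => //; rewrite ?invr_ge0 ?(ltW M0)// ?ge_min ?lexx ?orbT// lef_pV2.
have p0 w : (0 <= p w)%R by exact: le_trans (c0 w) (cp w).
have p'0 w : (0 <= p' w)%R by exact: le_trans (c0 w) (cp' w).
have mE' A : measurable A -> m A = \int[P]_w (p w * \1_A (s1 w))%:E.
  move=> mA; rewrite mE// /kernel_posterior ZE/= -marg1// muleC -ge0_integralM_EFin//.
  - by apply: eq_integral => w _; rewrite mulrA.
  - by apply: measurable_funM => //; apply: measurableT_comp ms1; exact: mI.
  - by rewrite invr_ge0 ltW.
  - by move=> w; rewrite mulr_ge0// /q1.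
have m'E' A : measurable A -> m' A = \int[P]_w (p' w * \1_A (s2 w))%:E.
  move=> mA; rewrite m'E// /kernel_posterior Z'E/= -marg2// muleC -ge0_integralM_EFin//.
  - by apply: eq_integral => w _; rewrite mulrA.
  - by apply: measurable_funM => //; apply: measurableT_comp ms2; exact: mI.
  - by rewrite invr_ge0 ltW.
  - by move=> w; rewrite mulr_ge0// /q2.
have m1 : m setT = 1 by rewrite mE// /kernel_posterior ZE -EFinM divff// gt_eqF.
have m'1 : m' setT = 1 by rewrite m'E// /kernel_posterior Z'E -EFinM divff// gt_eqF.
have pT : \int[P]_w (p w)%:E = 1.
  by rewrite -m1 mE'//; apply: eq_integral => w _; rewrite indicT mulr1.
have p'T : \int[P]_w (p' w)%:E = 1.
  by rewrite -m'1 m'E'//; apply: eq_integral => w _; rewrite indicT mulr1.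
have [T T0 TE] : exists2 T : R, (0 <= T)%R & \int[g]_z (dist z.1 z.2)%:E = T%:E.
  have a0 : 0 <= \int[g]_z (dist z.1 z.2)%:E.
    by apply: integral_ge0 => z _; rewrite lee_fin.
  have aD : \int[g]_z (dist z.1 z.2)%:E <= D%:E.
    apply: (@le_trans _ _ (\int[g]_z D%:E)); last first.
      by rewrite integral_cst// [X in _ * X](probability_setT g) mule1.
    apply: ge0_le_integral_nonmeasurable => z; rewrite lee_fin//.
    by have /andP[] := distD z.1 z.2.
  exists (fine (\int[g]_z (dist z.1 z.2)%:E)); first exact: fine_ge0.
  by rewrite fineK// ge0_fin_numE//; apply: le_lt_trans aD (ltry _).
have mds : measurable_fun setT (fun w => dist (s1 w) (s2 w)).
  exact: (measurableT_comp mdist (measurable_fun_pair ms1 ms2)).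
have bound (f : E * (X * X) -> R) (K : R) : (0 <= K)%R ->
    measurable_fun setT f -> (forall w, 0 <= f w)%R ->
    (forall x x', \int[rho]_e (f (e, (x, x')))%:E <= (K * dist x x')%:E) ->
    \int[P]_w (M^-1 * f w)%:E <= (M^-1 * (K * T))%:E.
  move=> K0 mf f0 fK; rewrite ge0_integralM_EFin ?invr_ge0 ?(ltW M0)// EFinM.
  apply: lee_wpmul2l; first by rewrite lee_fin invr_ge0 ltW.
  rewrite fub// EFinM -TE -ge0_integralM_EFin//.
  apply: ge0_le_integral_nonmeasurable => -[x x'] //=.
  by apply: integral_ge0 => e _; rewrite lee_fin.
have mpc : measurable_fun setT (fun w => p w - c w)%R by exact: measurable_funB.
have mpc' : measurable_fun setT (fun w => p' w - c w)%R by exact: measurable_funB.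
have pc0 w : (0 <= p w - c w)%R by rewrite subr_ge0.
have pc'0 w : (0 <= p' w - c w)%R by rewrite subr_ge0.
have mass1 : \int[P]_w (p w - c w)%:E + \int[P]_w (c w)%:E = 1.
  by rewrite -pT -ge0_integralD_EFin//; apply: eq_integral => w _; rewrite subrK.
have mass2 : \int[P]_w (p' w - c w)%:E + \int[P]_w (c w)%:E = 1.
  by rewrite -p'T -ge0_integralD_EFin//; apply: eq_integral => w _; rewrite subrK.
have [l lE lE'] : exists2 l : R, \int[P]_w (p w - c w)%:E = l%:E &
    \int[P]_w (p' w - c w)%:E = l%:E.
  have i0 : 0 <= \int[P]_w (c w)%:E by apply: integral_ge0 => w _; rewrite lee_fin.
  have i1 : 0 <= \int[P]_w (p w - c w)%:E by apply: integral_ge0 => w _; rewrite lee_fin.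
  have i2 : 0 <= \int[P]_w (p' w - c w)%:E by apply: integral_ge0 => w _; rewrite lee_fin.
  move: mass1 mass2 i0 i1 i2; case: (integral _ _ (fun w => (c w)%:E)) => [z| |];
    case: (integral _ _ (fun w => (p w - c w)%:E)) => [x| |];
    case: (integral _ _ (fun w => (p' w - c w)%:E)) => [y| |] //.
  rewrite -!EFinD => -[h1] -[h2] _ _ _; exists x => //.
  by congr EFin; lra.
have lT : (l <= M^-1 * (L * T))%R.
  have mab : measurable_fun setT (fun w => `|q1 w - q2 w|)%R.
    by apply: measurableT_comp => //; exact: measurable_funB.
  have Mi : (0 <= M^-1)%R by rewrite invr_ge0 ltW.
  rewrite -lee_fin; apply: le_trans (bound _ L L0 mab (fun w => normr_ge0 _) hL).
  (* Both residuals have mass [l], so the one whose evidence equals [M] may be used: there the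
     residual density is [(qi - min (q1, q2)) / M], at most [|q1 - q2| / M]. *)
  have [ZM|ZM] : M = Z \/ M = Z' by rewrite /M; case: (leP Z Z') => _; [right|left].
    rewrite -lE; apply: ge0_le_integral_nonmeasurable => w; rewrite lee_fin//.
    rewrite /p /c -ZM -mulrBr; apply: ler_wpM2l => //.
    by case: (leP (q1 w) (q2 w)) => h; rewrite ?subrr// ger0_norm ?subr_ge0// ltW.
  rewrite -lE'; apply: ge0_le_integral_nonmeasurable => w; rewrite lee_fin//.
  rewrite /p' /c -ZM -mulrBr; apply: ler_wpM2l => //.
  case: (leP (q1 w) (q2 w)) => h; rewrite ?subrr//.
  by rewrite distrC ger0_norm ?subr_ge0.
apply: (le_trans (W1_le_overlap mu ms1 ms2 mp mp' mc c0 cp cp' mdist distD mE' m'E' m1 m'1 lE)).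
have cT : \int[P]_w (c w * dist (s1 w) (s2 w))%:E <= (M^-1 * (B * T))%:E.
  apply: le_trans (bound (fun w => q1 w * dist (s1 w) (s2 w))%R B B0 _ _ hB).
  - apply: ge0_le_integral_nonmeasurable => w; rewrite lee_fin.
      by apply: mulr_ge0; [exact: c0|exact: d0].
    rewrite /c -mulrA; apply: ler_wpM2l; first by rewrite invr_ge0 ltW.
    by apply: ler_wpM2r => //; rewrite ge_min lexx.
  - exact: measurable_funM.
  - by move=> w; rewrite mulr_ge0// /q1.
apply: (le_trans (leeD2r _ cT)).
rewrite TE -EFinD -EFinM lee_fin.
apply: (@le_trans _ _ (M^-1 * (B * T) + D * (M^-1 * (L * T)))%R).
  by rewrite lerD2l ler_wpM2l.
rewrite [leLHS](_ : _ = M^-1 * ((D * L + B) * T))%R; last by ring.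
rewrite [leRHS](_ : _ = Z^-1 * ((D * L + B) * T))%R; last by ring.
(* Replacing [M] by the smaller [Z] leaves a constant that depends on [mu] alone. *)
apply: ler_wpM2r.
  by rewrite mulr_ge0// addr_ge0// mulr_ge0.
by rewrite lef_pV2.
Qed.

(** Infimum of the previous bound over all couplings. The slack in [D * L + B <= K] accommodates the
    factor 2 of the required constants. *)
Theorem kernel_posterior_W1 (mu mu' : probability X R) (m m' : set X -> \bar R) (K : R) :
  (D * L + B <= K)%R -> 0 < kernel_update mu setT < +oo -> 0 < kernel_update mu' setT < +oo ->
  (forall A, measurable A -> m A = kernel_posterior mu A) ->
  (forall A, measurable A -> m' A = kernel_posterior mu' A) ->
  W1 dist m m' <= (K / fine (kernel_update mu setT))%:E * W1 dist mu mu'.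
Proof.
move=> DLB Z0 Z'0 mE m'E.
have D0 : (0 <= D)%R by have /andP[h1 h2] := distD point point; exact: le_trans h2.
have W g := kernel_posterior_coupling Z0 Z'0 mE m'E (g := g).
have [z z0 ZE] := evidence_gt0 Z0; rewrite ZE/= in W *.
have : (0 <= (D * L + B) / z)%R.
  by rewrite divr_ge0 ?(ltW z0)// addr_ge0// mulr_ge0.
have W0 : 0 <= W1 dist mu mu'.
  apply: le_ereal_inf_tmp => _ [g _ <-]; apply: integral_ge0 => u _.
  by rewrite lee_fin; have /andP[] := distD u.1 u.2.
move=> K0; apply: (@le_trans _ _ (((D * L + B) / z)%:E * W1 dist mu mu')); last first.
  by apply: lee_wpmul2r => //; rewrite lee_fin ler_pM2r// invr_gt0.
(* A positive constant is divided out before passing to the infimum. If it is 0, one coupling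
   suffices, and the product supplies it. *)
move: K0; rewrite le_eqVlt => /orP[/eqP K0|K0].
  have gC : coupling (mu \x mu') mu mu'.
    move=> A mA; rewrite !product_measure1E//.
    by split; [rewrite [X in _ * X](probability_setT mu') mule1
              |rewrite [X in X * _](probability_setT mu) mul1e].
  by have := W _ gC; rewrite -K0 !mul0e.
rewrite -lee_pdivrMl//; apply: le_ereal_inf_tmp => _ [g gC <-].
by rewrite lee_pdivrMl//; exact: W.
Qed.

End kernel_wasserstein.

(** * The three estimation problems *)

Section polish_metric.
Context {R : realType} {d : measure_display} {T : measurableType d}.

Lemma countable_bigcup_measurable d' (U : measurableType d') (I : Type) (S : set I)
    (F : I -> set U) : countable S -> (forall i, measurable (F i)) ->
  measurable (\bigcup_(i in S) F i).
Proof.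
move=> /countable_injP[f finj] mF.
have -> : \bigcup_(i in S) F i = \bigcup_n \bigcup_(i in [set i | S i /\ f i = n]) F i.
  apply/seteqP; split=> x [i]; first by move=> Si Fx; exists (f i) => //; exists i.
  by move=> _ [j [Sj _] Fx]; exists j.
apply: bigcup_measurable => n _.
have [[i [Si fin]]|none] := pselect (exists i, S i /\ f i = n).
  rewrite (_ : [set _ | _] = [set i]) ?bigcup_set1//.
  apply/seteqP; split=> [j [Sj fj]|j ->] //=.
  by apply: finj; rewrite ?inE// fj.
by rewrite bigcup0// => i Si; case: none; exists i.
Qed.

(** Separability puts the metric in the product sigma-algebra: [dist x y < r] is a countable union
    of products of balls with a common center in the dense set and radii [p] and [r - p], [p]
    rational. *)
Lemma polish_dist_measurable (dist : T -> T -> R) : polish_borel dist ->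
  measurable_fun setT (fun z : T * T => dist z.1 z.2).
Proof.
move=> [[dist0 dist_eq dist_sym dist_tri] _ [S cS dS] borel].
have ball_measurable s r : measurable [set x | dist s x < r].
  apply/borel; apply: sub_sigma_algebra => x /= sx.
  exists (r - dist s x); first by rewrite subr_gt0.
  by move=> z; rewrite ltrBrDl; exact/le_lt_trans/dist_tri.
apply: (measurability _ (RGenInftyO.measurableE R)) => _ [_ [r ->] <-].
rewrite setTI.
have -> : (fun z : T * T => dist z.1 z.2) @^-1` `]-oo, r[%classic =
    \bigcup_(s in S) \bigcup_(p in [set: rat])
      ([set x | dist s x < ratr p] `*` [set x | dist s x < r - ratr p]).
  apply/seteqP; split=> [[x y] /=|[x y] [s Ss [p _ [/= xp yp]]]].
    rewrite in_itv/= => xyr.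
    (* With [s] within half the gap of [x], [dist s x + dist s y <= 2 dist s x + dist x y < r],
       which leaves room for a rational radius. *)
    have e0 : 0 < (r - dist x y) / 2 by rewrite divr_gt0// subr_gt0.
    have [s Ss xs] := dS x _ e0; rewrite dist_sym in xs.
    have h : dist s x < r - dist s y.
      by have := dist_tri s x y; lra.
    have [p] := rat_in_itvoo h; rewrite in_itv/= => /andP[h1 h2].
    by exists s => //; exists p => //; split => //=; lra.
  rewrite /= in_itv/=; apply: le_lt_trans (dist_tri x s y) _.
  by rewrite dist_sym; lra.
apply: countable_bigcup_measurable => // s.
by apply: bigcupT_measurable_rat => p; exact: measurableX.
Qed.

End polish_metric.

(** * Finite suprema and integrated Lipschitz constants *)

Section lipschitz_constants.
Context {R : realType} {dE d : measure_display} {E : measurableType dE}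
  {T : measurableType d}.
Implicit Types (dist : T -> T -> R).
Local Open Scope ereal_scope.

Lemma le_esup_fun (U : Type) (f : U -> R) x :
  esup_fun f < +oo -> (f x <= fine (esup_fun f))%R.
Proof.
have h : (f x)%:E <= esup_fun f by apply: ereal_sup_ubound; exists x.
by move: h; case: (esup_fun f) => [r| |]//; rewrite leeNy_eq.
Qed.

Lemma fine_ereal_sup_ge (I : Type) (F : I -> \bar R) i :
  ereal_sup [set F i | i in [set: I]] < +oo -> 0 <= F i ->
  F i <= (fine (ereal_sup [set F i | i in [set: I]]))%:E.
Proof.
have h : F i <= ereal_sup [set F i | i in [set: I]] by apply: ereal_sup_ubound; exists i.
by move=> sfin Fi0; rewrite fineK// ge0_fin_numE//; exact: le_trans h.
Qed.

Lemma dist_le_diam dist x y : is_metric dist -> diam dist < +oo ->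
  (0 <= dist x y <= fine (diam dist))%R.
Proof.
move=> [d0 _ _ _] dfin; rewrite d0/=.
have h : (dist x y)%:E <= diam dist by apply: ereal_sup_ubound; exists (x, y).
by move: h dfin; case: (diam dist) => [r| |]//; rewrite leeNy_eq.
Qed.

(* On a one-point space the suprema defining [Lf] range over the empty set and
   are [-oo]; the diameter is then [0]. *)
Lemma lipschitz_kernel_bound (rho : {measure set E -> \bar R}) (q : E -> T -> R)
    (Lf : E -> \bar R) dist :
  is_metric dist -> diam dist < +oo ->
  (forall e x x', x <> x' -> (`|q e x - q e x'| / dist x x')%:E <= Lf e) ->
  \int[rho]_e Lf e < +oo -> (forall x, measurable_fun setT (q ^~ x)) ->
  exists L, [/\ (0 <= L)%R,
    forall x x', \int[rho]_e (`|q e x - q e x'|)%:E <= (L * dist x x')%:E &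
    (fine (diam dist) * L <= 2 * fine (diam dist) * fine (\int[rho]_e Lf e))%R].
Proof.
move=> md dfin qL Lfin mq; have [d0 deq _ _] := md.
have dxx x : dist x x = 0%R by apply/deq.
have D0 : (0 <= fine (diam dist))%R.
  by have /andP[h1 h2] := dist_le_diam point point md dfin; exact: le_trans h2.
have qxx x : \int[rho]_e (`|q e x - q e x|)%:E = 0.
  by rewrite integral0_eq// => e _; rewrite subrr normr0.
have [[[x x'] /= xx']|alleq] := pselect (exists z : T * T, z.1 <> z.2).
  have Lf0 e : 0 <= Lf e.
    by apply: le_trans (qL e _ _ xx'); rewrite lee_fin divr_ge0.
  have I0 : 0 <= \int[rho]_e Lf e by exact: integral_ge0.
  have L0 : (0 <= fine (\int[rho]_e Lf e))%R by apply: fine_ge0.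
  exists (fine (\int[rho]_e Lf e)); split=> //; last first.
    by have := mulr_ge0 D0 L0; lra.
  move=> u u'; have [->|uu'] := pselect (u = u'); first by rewrite qxx dxx mulr0.
  have duu : (0 < dist u u')%R.
    by rewrite lt_neqAle d0 andbT eq_sym; apply/eqP => /deq.
  rewrite mulrC EFinM fineK ?ge0_fin_numE// -lee_pdivrMl//.
  rewrite -ge0_integralM_EFin ?invr_ge0//; last first.
    by apply: measurableT_comp => //; exact: measurable_funB.
  apply: ge0_le_integral_nonmeasurable => e.
    by rewrite lee_fin mulr_ge0 ?invr_ge0.
  by rewrite mulrC; exact: qL.
exists 0%R; split=> //.
  move=> x x'; have -> : x = x'.
    by apply: contrapT => xx'; apply: alleq; exists (x, x').
  by rewrite qxx mul0r.
rewrite mulr0; suff -> : diam dist = 0 by rewrite mulr0 mul0r.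
apply/eqP; rewrite eq_le; apply/andP; split.
  apply: ge_ereal_sup => _ [[x x'] _ <-] /=.
  have -> : x = x' by apply: contrapT => xx'; apply: alleq; exists (x, x').
  by rewrite dxx.
have : (dist point point)%:E <= diam dist by apply: ereal_sup_ubound; exists (point, point).
by rewrite dxx.
Qed.

End lipschitz_constants.

(** * Inverse problems as kernel updates *)

Section inverse_problem.
Context {R : realType} {d : measure_display} {X : measurableType d}.
Variable h : X -> R.
Local Open Scope ereal_scope.
Hypotheses (mh : measurable_fun setT h) (h0 : forall x, (0 <= h x)%R).

Let q (_ : unit) (x : X) := h x.
Let th (_ : unit) (x : X) := x.
Let rho : probability unit R := \d_tt.

Lemma integral_dirac_unit (c : \bar R) : \int[rho]_e c = c.
Proof. by rewrite integral_cst// [X in _ * X](probability_setT rho) mule1. Qed.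

Lemma tpost_IP_kernel (mu : probability X R) A : 
  \int[mu]_(x in A) (h x)%:E = kernel_update rho q th mu A.
Proof.
rewrite integral_indicr; apply: eq_integral => x _.
by rewrite -[RHS]/(\int[rho]_e (h x * \1_A x)%:E) integral_dirac_unit.
Qed.

Lemma post_IP_kernel (mu : probability X R) A :
  post_IP mu h A = kernel_posterior rho q th mu A.
Proof. by rewrite /post_IP /evid_IP !tpost_IP_kernel. Qed.

End inverse_problem.

(** * State estimation as a kernel update *)

Section state_estimation.
Context {R : realType} {d : measure_display} {X : measurableType d}.
Variables (leb : {sigma_finite_measure set X -> \bar R}) (h : X -> R) (Tk : X -> X -> R).
Local Open Scope ereal_scope.
Hypotheses (mh : measurable_fun setT h) (h0 : forall x, (0 <= h x)%R).
Hypotheses (mT : measurable_fun setT (fun z : X * X => Tk z.1 z.2))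
  (T0 : forall x x', (0 <= Tk x x')%R).

Let q (e x : X) := (h e * Tk e x)%R.
Let th (e x : X) := e.

Lemma measurable_SE_kernel : measurable_fun setT (fun z : X * X => q z.1 z.2).
Proof. by apply: measurable_funM => //; exact: (measurableT_comp mh measurable_fst). Qed.

Lemma tpost_SE_kernel (mu : probability X R) A : measurable A ->
  tpost_SE leb mu h Tk A = kernel_update leb q th mu A.
Proof.
move=> mA; rewrite /kernel_update /kernel_int.
have mI : measurable_fun setT (\1_A : X -> R) by exact: measurable_indic.
pose f (z : X * X) := (q z.1 z.2 * \1_A z.1)%R.
have mf : measurable_fun setT f.
  apply: measurable_funM; first exact: measurable_SE_kernel.
  exact: (measurableT_comp mI measurable_fst).
have f0 z : (0 <= f z)%R by rewrite !mulr_ge0.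
rewrite -(fubini_tonelli (EFin \o f))//=; last exact/measurable_EFinP.
rewrite /tpost_SE integral_mkcond; apply: eq_integral => e _.
have mTe : measurable_fun setT (Tk e) by exact: (measurableT_comp mT (pair1_measurable e)).
rewrite patchE /f/=; case: ifPn => eA.
  rewrite /pred_SE -ge0_integralM_EFin//.
  by apply: eq_integral => x _; rewrite indicE eA mulr1.
by rewrite integral0_eq// => x _; rewrite indicE (negbTE eA) mulr0.
Qed.

Lemma post_SE_kernel (mu : probability X R) A : measurable A ->
  post_SE leb mu h Tk A = kernel_posterior leb q th mu A.
Proof. by move=> mA; rewrite /post_SE /evid_SE !tpost_SE_kernel. Qed.

End state_estimation.

(** * Parameter-state estimation as a kernel update *)

Section parameter_state_estimation.
Context {R : realType} {dx dw : measure_display} {X : measurableType dx}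
  {W : measurableType dw}.
Variables (lebX : {sigma_finite_measure set X -> \bar R})
  (lebW : {sigma_finite_measure set W -> \bar R})
  (h : X -> W -> R) (Tk : X -> X -> W -> R).
Local Open Scope ereal_scope.
Hypotheses (mh : measurable_fun setT (fun z : X * W => h z.1 z.2))
  (h0 : forall x w, (0 <= h x w)%R).
Hypotheses (mT : measurable_fun setT (fun z : X * X * W => Tk z.1.1 z.1.2 z.2))
  (T0 : forall x x' w, (0 <= Tk x x' w)%R).

Let q (e : X) (z : X * W) := (h e z.2 * Tk e z.1 z.2)%R.
Let th (e : X) (z : X * W) := (e, z.2).

Lemma measurable_PS_point :
  measurable_fun setT (fun z : X * (X * W) => th z.1 z.2).
Proof.
apply: measurable_fun_pair => //.
exact: (measurableT_comp measurable_snd measurable_snd).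
Qed.

Lemma measurable_PS_kernel :
  measurable_fun setT (fun z : X * (X * W) => q z.1 z.2).
Proof.
apply: measurable_funM; first exact: (measurableT_comp mh measurable_PS_point).
have m3 : measurable_fun setT (fun z : X * (X * W) => ((z.1, z.2.1), z.2.2)).
  apply: measurable_fun_pair.
    apply: measurable_fun_pair => //.
    exact: (measurableT_comp measurable_fst measurable_snd).
  exact: (measurableT_comp measurable_snd measurable_snd).
exact: (measurableT_comp mT m3).
Qed.

(** Once [mu] is written through [pi], both sides are integrals over the new state, the old state
    and the parameter; they differ in the order of the two states. *)
Lemma tpost_PS_kernel (mu : probability (X * W)%type R) (pi : X * W -> R) A :
  prior_density (lebX \x lebW) mu pi -> measurable A ->
  tpost_PS lebX (lebX \x lebW) h Tk pi A = kernel_update lebX q th mu A.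
Proof.
move=> [mpi pi0 piE] mA.
have mI : measurable_fun setT (\1_A : X * W -> R) by exact: measurable_indic.
have I0 z : (0 <= (\1_A : X * W -> R) z)%R by rewrite indicE.
have mk : measurable_fun setT (kernel_int lebX q th \1_A).
  apply: measurable_kernel_int => //; first exact: measurable_PS_kernel.
    by move=> e z; rewrite mulr_ge0.
  exact: measurable_PS_point.
pose K : X * W -> \bar R := kernel_int lebX q th \1_A.
have K0 z : 0 <= K z by apply: kernel_int_ge0 => // e z'; rewrite mulr_ge0.
have muE : kernel_update lebX q th mu A = \int[lebX \x lebW]_z ((pi z)%:E * K z).
  apply: (@ge0_integral_pushforward_density _ _ _ _ _ (lebX \x lebW) mu pi id K) => //.
  by move=> B mB; rewrite -integral_indicr; exact: piE.
pose k z := (h z.1 z.2 * \1_A z)%R.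
have k0 z : (0 <= k z)%R by rewrite mulr_ge0.
have mk' : measurable_fun setT k by exact: measurable_funM.
pose G (u : X * W * X) := (Tk u.1.1 u.2 u.1.2 * pi (u.2, u.1.2))%R.
have G0 u : (0 <= G u)%R by rewrite mulr_ge0.
have mG : measurable_fun setT G.
  have m12 : measurable_fun setT (fun u : X * W * X => u.1.2).
    exact: (measurableT_comp measurable_snd measurable_fst).
  have m11 : measurable_fun setT (fun u : X * W * X => u.1.1).
    exact: (measurableT_comp measurable_fst measurable_fst).
  apply: measurable_funM.
    have m3 : measurable_fun setT (fun u : X * W * X => ((u.1.1, u.2), u.1.2)).
      by apply: measurable_fun_pair => //; exact: measurable_fun_pair.
    exact: (measurableT_comp mT m3).
  have m2 : measurable_fun setT (fun u : X * W * X => (u.2, u.1.2)).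
    exact: measurable_fun_pair.
  exact: (measurableT_comp mpi m2).
have mpred : measurable_fun setT (fun z => pred_PS lebX Tk pi z.1 z.2).
  apply: (measurable_fun_fubini_tonelli_F (m2 := lebX) (EFin \o G)).
    exact/measurable_EFinP.
  by move=> u; rewrite /= lee_fin.
have pred0 z : 0 <= pred_PS lebX Tk pi z.1 z.2.
  by apply: integral_ge0 => x' _; rewrite lee_fin mulr_ge0.
rewrite [LHS](_ : _ = \int[lebX \x lebW]_z ((k z)%:E * pred_PS lebX Tk pi z.1 z.2)); last first.
  rewrite /tpost_PS integral_mkcond; apply: eq_integral => z _.
  by rewrite patchE /k indicE; case: ifPn => zA; rewrite ?mulr1// mulr0 mul0e.
have leftE : \int[lebX \x lebW]_z ((k z)%:E * pred_PS lebX Tk pi z.1 z.2) =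
    \int[lebW]_w \int[lebX]_x ((k (x, w))%:E * pred_PS lebX Tk pi x w).
  apply: (fubini_tonelli2 (fun z => (k z)%:E * pred_PS lebX Tk pi z.1 z.2)).
  - by apply: emeasurable_funM => //; exact/measurable_EFinP.
  - by move=> z; rewrite mule_ge0 ?lee_fin.
have rightE : \int[lebX \x lebW]_z ((pi z)%:E * K z) =
    \int[lebW]_w \int[lebX]_x ((pi (x, w))%:E * K (x, w)).
  apply: (fubini_tonelli2 (fun z => (pi z)%:E * K z)).
  - by apply: emeasurable_funM => //; exact/measurable_EFinP.
  - by move=> z; rewrite mule_ge0 ?lee_fin.
(* The parameter is kept by the update, so [w] can be frozen and Tonelli exchanges the two
   states. *)
rewrite muE rightE leftE; apply: eq_integral => w _.
have mw := @pair2_measurable _ _ X W w.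
have mGw x : measurable_fun setT (fun x' => G ((x, w), x')).
  exact: (measurableT_comp mG (pair1_measurable (x, w))).
under eq_integral => x _.
  rewrite -[pred_PS _ _ _ _ _]/(\int[lebX]_x' (G ((x, w), x'))%:E).
  rewrite -ge0_integralM_EFin//.
  over.
pose F (u : X * X) := (k (u.1, w) * G ((u.1, w), u.2))%R.
have mF : measurable_fun setT F.
  have mp : measurable_fun setT (fun u : X * X => (u.1, w)).
    exact: (measurableT_comp mw measurable_fst).
  apply: measurable_funM; first exact: (measurableT_comp mk' mp).
  have mp' : measurable_fun setT (fun u : X * X => ((u.1, w), u.2)).
    exact: measurable_fun_pair.
  exact: (measurableT_comp mG mp').
have F0 u : (0 <= F u)%R by rewrite mulr_ge0.
rewrite (fubini_tonelli (EFin \o F))//=; last exact/measurable_EFinP.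
apply: eq_integral => x' _; rewrite /kernel_int -ge0_integralM_EFin//.
- by apply: eq_integral => x _; congr EFin; rewrite /F /k /G /q /th/=; ring.
- exact: (measurableT_comp (measurable_kernel_integrand measurable_PS_kernel
    measurable_PS_point mI) (pair2_measurable (x', w))).
- by move=> e; rewrite !mulr_ge0.
Qed.

Lemma post_PS_kernel (mu : probability (X * W)%type R) (pi : X * W -> R) A :
  prior_density (lebX \x lebW) mu pi -> measurable A ->
  post_PS lebX (lebX \x lebW) h Tk pi A = kernel_posterior lebX q th mu A.
Proof. by move=> dpi mA; rewrite /post_PS /evid_PS !(tpost_PS_kernel dpi). Qed.

End parameter_state_estimation.

(** * The nine cases as instances of the three kernel bounds *)

Theorem theorem1 (R : realType) :
  (* ---------------- Inverse problems: cases (a), (b), (c) ---------------- *)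
  (forall (d : measure_display) (X : measurableType d) (dX : X -> X -> R)
      (Y : Type) (h : Y -> X -> R) (y : Y),
    polish_borel dX ->
    measurable_fun setT (h y) -> (forall x, 0 <= h y x) ->
    let Ch := esup_fun (h y) in
    let Z := fun mu : set X -> \bar R => evid_IP mu (h y) in
    let F := fun mu : set X -> \bar R => post_IP mu (h y) in
    (* (a) total variation, under (IP.1) *)
    ((Ch < +oo)%E ->
      forall mu mu' : probability X R,
        admissible_IP mu (h y) -> admissible_IP mu' (h y) ->
        forall r r', is_dTV (F mu) (F mu') r -> is_dTV mu mu' r' ->
          r <= fine Ch / fine (Z mu) * r')
    /\
    (* (b) Hellinger, under (IP.1) *)
    ((Ch < +oo)%E ->
      forall mu mu' : probability X R,
        admissible_IP mu (h y) -> admissible_IP mu' (h y) ->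
        forall r r', is_dH (F mu) (F mu') r -> is_dH mu mu' r' ->
          r <= 2 * Num.sqrt (fine Ch / fine (Z mu)) * r')
    /\
    (* (c) Wasserstein-1, under (IP.1), (IP.2), (B) *)
    ((Ch < +oo)%E -> (lip_const dX (h y) < +oo)%E -> (diam dX < +oo)%E ->
      forall mu mu' : probability X R,
        admissible_IP mu (h y) -> first_moment_finite dX mu ->
        admissible_IP mu' (h y) -> first_moment_finite dX mu' ->
        (W1 dX (F mu) (F mu') <=
          ((2 * fine (diam dX) * fine (lip_const dX (h y)) + fine Ch)
             / fine (Z mu))%:E * W1 dX mu mu')%E))
  /\
  (* ---------------- State estimation: cases (d), (e), (f) ---------------- *)
  (forall (d : measure_display) (X : measurableType d) (dX : X -> X -> R)
      (leb : {sigma_finite_measure set X -> \bar R})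
      (Tk : X -> X -> R) (Y : Type) (h : Y -> X -> R) (y : Y),
    polish_borel dX ->
    measurable_fun setT (fun z : X * X => Tk z.1 z.2) ->
    (forall x x', 0 <= Tk x x') ->
    (forall x', (\int[leb]_x (Tk x x')%:E = 1)%E) ->
    measurable_fun setT (h y) -> (forall x, 0 <= h y x) ->
    let CTh := C_Th leb (h y) Tk in
    let CsTh := Cstar_Th leb dX (h y) Tk in
    let Z := fun mu : set X -> \bar R => evid_SE leb mu (h y) Tk in
    let F := fun mu : set X -> \bar R => post_SE leb mu (h y) Tk in
    (* (d) total variation, under (SE.1) *)
    ((CTh < +oo)%E ->
      forall mu mu' : probability X R,
        admissible_SE leb mu (h y) Tk -> admissible_SE leb mu' (h y) Tk ->
        forall r r', is_dTV (F mu) (F mu') r -> is_dTV mu mu' r' ->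
          r <= fine CTh / fine (Z mu) * r')
    /\
    (* (e) Hellinger, under (SE.1) *)
    ((CTh < +oo)%E ->
      forall mu mu' : probability X R,
        admissible_SE leb mu (h y) Tk -> admissible_SE leb mu' (h y) Tk ->
        forall r r', is_dH (F mu) (F mu') r -> is_dH mu mu' r' ->
          r <= 2 * Num.sqrt (fine CTh / fine (Z mu)) * r')
    /\
    (* (f) Wasserstein-1, under (SE.2), (B) *)
    ((forall xk, (T_lip dX Tk xk < +oo)%E) -> (CsTh < +oo)%E ->
      (diam dX < +oo)%E ->
      forall mu mu' : probability X R,
        admissible_SE leb mu (h y) Tk -> first_moment_finite dX mu ->
        admissible_SE leb mu' (h y) Tk -> first_moment_finite dX mu' ->
        (W1 dX (F mu) (F mu') <=
          ((2 * fine (diam dX) * fine CsTh) / fine (Z mu))%:E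
            * W1 dX mu mu')%E))
  /\
  (* ----------- Parameter-state estimation: cases (g), (h), (i) ----------- *)
  (forall (dx dw : measure_display) (X : measurableType dx) (W : measurableType dw)
      (dXW : X * W -> X * W -> R)
      (lebX : {sigma_finite_measure set X -> \bar R})
      (lebW : {sigma_finite_measure set W -> \bar R})
      (Tk : X -> X -> W -> R) (Y : Type) (h : Y -> X -> W -> R) (y : Y),
    polish_borel dXW ->
    measurable_fun setT (fun z : X * X * W => Tk z.1.1 z.1.2 z.2) ->
    (forall x x' w, 0 <= Tk x x' w) ->
    (forall x' w, (\int[lebX]_x (Tk x x' w)%:E = 1)%E) ->
    measurable_fun setT (fun z : X * W => h y z.1 z.2) ->
    (forall x w, 0 <= h y x w) ->
    let lam := (lebX \x lebW)%E in
    let tCTh := tC_Th lebX (h y) Tk in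
    let tCsTh := tCstar_Th lebX dXW (h y) Tk in
    let Z := fun pi : X * W -> R => evid_PS lebX lam (h y) Tk pi in
    let F := fun pi : X * W -> R => post_PS lebX lam (h y) Tk pi in
    (* (g) total variation, under (PS.1) *)
    ((tCTh < +oo)%E ->
      forall (mu mu' : probability (X * W)%type R) (pi pi' : X * W -> R),
        admissible_PS lebX lam mu (h y) Tk pi ->
        admissible_PS lebX lam mu' (h y) Tk pi' ->
        forall r r', is_dTV (F pi) (F pi') r -> is_dTV mu mu' r' ->
          r <= fine tCTh / fine (Z pi) * r')
    /\
    (* (h) Hellinger, under (PS.1) *)
    ((tCTh < +oo)%E ->
      forall (mu mu' : probability (X * W)%type R) (pi pi' : X * W -> R),
        admissible_PS lebX lam mu (h y) Tk pi ->
        admissible_PS lebX lam mu' (h y) Tk pi' ->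
        forall r r', is_dH (F pi) (F pi') r -> is_dH mu mu' r' ->
          r <= 2 * Num.sqrt (fine tCTh / fine (Z pi)) * r')
    /\
    (* (i) Wasserstein-1, under (PS.1), (PS.2), (PS.3), (B) *)
    ((tCTh < +oo)%E ->
      (forall xk, (f_lip dXW (h y) Tk xk < +oo)%E) -> (tCsTh < +oo)%E ->
      (forall (x xt x' : X) (w w' : W),
         dXW (x, w) (x, w') <= dXW (xt, w) (x', w')) ->
      (diam dXW < +oo)%E ->
      forall (mu mu' : probability (X * W)%type R) (pi pi' : X * W -> R),
        admissible_PS lebX lam mu (h y) Tk pi -> first_moment_finite dXW mu ->
        admissible_PS lebX lam mu' (h y) Tk pi' -> first_moment_finite dXW mu' ->
        (W1 dXW (F pi) (F pi') <=
          ((2 * fine (diam dXW) * fine tCsTh + fine tCTh) / fine (Z pi))%:E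
            * W1 dXW mu mu')%E)).
Proof.
split; [|split].
- move=> d X dX Y h y pb mh h0 Ch Z F.
  have mh' : measurable_fun setT (fun z : unit * X => h y z.2).
    exact: (measurableT_comp mh measurable_snd).
  have q0 (e : unit) x : 0 <= h y x by [].
  have mth : measurable_fun setT (fun z : unit * X => z.2) by exact: measurable_snd.
  have ZE (mu : probability X R) := tpost_IP_kernel (h y) mu setT.
  have FE (mu : probability X R) A (_ : measurable A) := post_IP_kernel (h y) mu A.
  have qC : (Ch < +oo)%E ->
      forall x, (\int[\d_tt : probability unit R]_e (h y x)%:E <= (fine Ch)%:E)%E.
    by move=> Cfin x; rewrite integral_dirac_unit lee_fin; exact: le_esup_fun.
  rewrite /Z /F /admissible_IP /evid_IP; split; [|split].
  + move=> Cfin mu mu'; rewrite !ZE => Z0 Z'0 r r' mr mr'.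
    exact: (kernel_posterior_dTV mh' q0 mth (qC Cfin) Z0 Z'0 (FE mu) (FE mu') mr mr').
  + move=> Cfin mu mu'; rewrite !ZE => Z0 Z'0 r r' mr mr'.
    exact: (kernel_posterior_dH mh' q0 mth (qC Cfin) Z0 Z'0 (FE mu) (FE mu') mr mr').
  + move=> Cfin Lfin Dfin mu mu'; rewrite !ZE => Z0 _ Z'0 _.
    have [md _ _ _] := pb.
    have distD x x' := dist_le_diam x x' md Dfin.
    have Ch0 : 0 <= fine Ch by exact: le_trans (h0 point) (le_esup_fun point Cfin).
    have [||//|L [L0 hL DL]] := @lipschitz_kernel_bound _ _ _ _ X
      (\d_tt : probability unit R) (fun _ => h y) (fun _ => lip_const dX (h y)) dX md Dfin.
    * by move=> _ x x' xx'; apply: ereal_sup_ubound; exists (x, x').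
    * by rewrite integral_dirac_unit.
    rewrite integral_dirac_unit in DL.
    (* Here [th] fixes [x], so the common mass travels [dist x x'] with weight [h y x]: [B] is the
       supremum of the likelihood. *)
    apply: (kernel_posterior_W1 mh' q0 mth (polish_dist_measurable pb) distD Ch0 L0
      _ hL _ Z0 Z'0 (FE mu) (FE mu')); last by rewrite lerD2r.
    move=> x x'; rewrite integral_dirac_unit lee_fin ler_wpM2r//.
      by have /andP[] := distD x x'.
    exact: le_esup_fun.
- move=> d X dX leb Tk Y h y pb mT T0 T1 mh h0 CTh CsTh Z F.
  have mq := measurable_SE_kernel mh mT.
  have q0 (e x : X) : 0 <= h y e * Tk e x by rewrite mulr_ge0.
  have mth : measurable_fun setT (fun z : X * X => z.1) by exact: measurable_fst.
  have ZE (mu : probability X R) := tpost_SE_kernel leb mh h0 mT T0 mu measurableT.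
  have FE (mu : probability X R) A := @post_SE_kernel _ _ _ leb _ _ mh h0 mT T0 mu A.
  have qC : (CTh < +oo)%E ->
      forall x, (\int[leb]_e (h y e * Tk e x)%:E <= (fine CTh)%:E)%E.
    move=> Cfin x.
    apply: (@fine_ereal_sup_ge _ _ (fun x => \int[leb]_e (h y e * Tk e x)%:E)%E x Cfin).
    by apply: integral_ge0 => e _; rewrite lee_fin.
  rewrite /Z /F /admissible_SE /evid_SE; split; [|split].
  + move=> Cfin mu mu'; rewrite !ZE => -[_ Z0] [_ Z'0] r r' mr mr'.
    exact: (kernel_posterior_dTV mq q0 mth (qC Cfin) Z0 Z'0 (FE mu) (FE mu') mr mr').
  + move=> Cfin mu mu'; rewrite !ZE => -[_ Z0] [_ Z'0] r r' mr mr'.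
    exact: (kernel_posterior_dH mq q0 mth (qC Cfin) Z0 Z'0 (FE mu) (FE mu') mr mr').
  + move=> Tfin Lfin Dfin mu mu'; rewrite !ZE => -[_ Z0] _ [_ Z'0] _.
    have [md _ _ _] := pb; have [_ deq _ _] := md.
    have distD x x' := dist_le_diam x x' md Dfin.
    have [|//||L [L0 hL DL]] := @lipschitz_kernel_bound _ _ _ _ X leb
      (fun e x => h y e * Tk e x) (fun e => ((h y e)%:E * T_lip dX Tk e)%E) dX md Dfin.
    * move=> e x x' xx'; rewrite -mulrBr normrM ger0_norm// -mulrA EFinM.
      apply: lee_wpmul2l; first by rewrite lee_fin.
      by apply: ereal_sup_ubound; exists (x, x').
    * by move=> x; exact: (measurableT_comp mq (pair2_measurable x)).
    (* Here [th e x = e] does not depend on [x], so the common mass stays in place and [B = 0]. *)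
    apply: (kernel_posterior_W1 mq q0 mth (polish_dist_measurable pb) distD (lexx 0) L0
      _ hL _ Z0 Z'0 (FE mu) (FE mu')); last by rewrite addr0.
    move=> x x'; rewrite mul0r integral0_eq// => e _.
    by have -> : dX e e = 0 by [exact/deq]; rewrite mulr0.
- move=> dx dw X W dXW lebX lebW Tk Y h y pb mT T0 T1 mh h0 lam tCTh tCsTh Z F.
  have mq := measurable_PS_kernel mh mT.
  have q0 (e : X) (z : X * W) : 0 <= h y e z.2 * Tk e z.1 z.2 by rewrite mulr_ge0.
  have mth := measurable_PS_point (X := X) (W := W).
  have ZE (mu : probability (X * W)%type R) pi dpi :=
    @tpost_PS_kernel _ _ _ _ _ lebX lebW _ _ mh h0 mT T0 mu pi setT dpi measurableT.
  have FE (mu : probability (X * W)%type R) pi dpi A :=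
    @post_PS_kernel _ _ _ _ _ lebX lebW _ _ mh h0 mT T0 mu pi A dpi.
  have qC : (tCTh < +oo)%E ->
      forall z, (\int[lebX]_e (h y e z.2 * Tk e z.1 z.2)%:E <= (fine tCTh)%:E)%E.
    move=> Cfin z; apply: (@fine_ereal_sup_ge _ _
      (fun z : X * W => \int[lebX]_e (h y e z.2 * Tk e z.1 z.2)%:E)%E z Cfin).
    by apply: integral_ge0 => e _; rewrite lee_fin.
  rewrite /Z /F /admissible_PS /evid_PS; split; [|split].
  + move=> Cfin mu mu' pi pi' [dpi _ Z0] [dpi' _ Z'0] r r' mr mr'.
    move: Z0 Z'0; rewrite (ZE _ _ dpi) (ZE _ _ dpi') => Z0 Z'0.
    exact: (kernel_posterior_dTV mq q0 mth (qC Cfin) Z0 Z'0 (FE mu _ dpi) (FE mu' _ dpi') mr mr').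
  + move=> Cfin mu mu' pi pi' [dpi _ Z0] [dpi' _ Z'0] r r' mr mr'.
    move: Z0 Z'0; rewrite (ZE _ _ dpi) (ZE _ _ dpi') => Z0 Z'0.
    exact: (kernel_posterior_dH mq q0 mth (qC Cfin) Z0 Z'0 (FE mu _ dpi) (FE mu' _ dpi') mr mr').
  + move=> Cfin ffin Lfin PS3 Dfin mu mu' pi pi' [dpi _ Z0] _ [dpi' _ Z'0] _.
    move: Z0 Z'0; rewrite (ZE _ _ dpi) (ZE _ _ dpi') => Z0 Z'0.
    have [md _ _ _] := pb.
    have distD x x' := dist_le_diam x x' md Dfin.
    have C0 : 0 <= fine tCTh.
      rewrite -lee_fin; apply: le_trans (qC Cfin point).
      by apply: integral_ge0 => e _; rewrite lee_fin.
    have [|//||L [L0 hL DL]] := @lipschitz_kernel_bound _ _ _ _ (X * W)%type lebX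
      (fun e z => h y e z.2 * Tk e z.1 z.2) (f_lip dXW (h y) Tk) dXW md Dfin.
    * by move=> e z z' zz'; apply: ereal_sup_ubound; exists (z, z').
    * by move=> z; exact: (measurableT_comp mq (pair2_measurable z)).
    (* The common mass moves from [(e, w)] to [(e, w')], which [PS3] bounds by the distance of the
       prior points; [B] is then the bound on the kernel mass. *)
    apply: (kernel_posterior_W1 mq q0 mth (polish_dist_measurable pb) distD C0 L0
      _ hL _ Z0 Z'0 (FE mu _ dpi) (FE mu' _ dpi')); last by rewrite lerD2r.
    move=> [x w] [x' w'] /=.
    have dd : 0 <= dXW (x, w) (x', w') by have /andP[] := distD (x, w) (x', w').
    apply: (@le_trans _ _ (\int[lebX]_e (dXW (x, w) (x', w') * (h y e w * Tk e x w))%:E)%E).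
      apply: ge0_le_integral_nonmeasurable => e; rewrite lee_fin.
        by rewrite !mulr_ge0//; have /andP[] := distD (e, w) (e, w').
      by rewrite mulrC; apply: ler_wpM2r; [exact: (q0 e (x, w))|exact: PS3].
    rewrite ge0_integralM_EFin//; last 2 first.
    * exact: (measurableT_comp mq (pair2_measurable (x, w))).
    * by move=> e; exact: (q0 e (x, w)).
    rewrite muleC EFinM; apply: lee_wpmul2r; first by rewrite lee_fin.
    exact: (qC Cfin (x, w)).
Qed.
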